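(* Let $p\neq 2$ be a prime. Let $C$ be an $m\times m$ matrix over $\mathbb{F}_p$ and assume that the minimal polynomial of $C^2$ is of the form $f(x)^k$, where $f(x)\in\mathbb{F}_p[x]$ is irreducible. Let $d=\deg f$, $q=p^d$, and let $\lambda$ be the partition of $m/d$ whose dual partition is $\lambda'=[d_1,\dots,d_k]$, $d_1\ge d_2\ge\dots\ge d_k$, where $$\frac1d\dim_{\mathbb{F}_p}\ker f(C^2)^j=d_1+\dots+d_j\qquad (1\le j\le k).$$ (1) If $\left(\frac{x}{f(x)}\right)=1$, then $N^*(C,C;p)=N^*_+(\lambda,q)$, where $$N^*_+(\lambda,q)=\sum_{\lambda=\mu+\nu}\frac{\#Z_{GL_{|\lambda|}(\mathbb{F}_q)}(N_\lambda)}{\#Z_{GL_{|\mu|}(\mathbb{F}_q)}(N_\mu)\;\#Z_{GL_{|\nu|}(\mathbb{F}_q)}(N_\nu)},$$ the sum being over all ordered pairs $(\mu,\nu)$ of (possibly empty) partitions with $\mu+\nu=\lambda$. (2) If $\left(\frac{x}{f(x)}\right)=-1$, then all $d_j$ are even, $\lambda=\mu+\mu$ for some partition $\mu$, and $N^*(C,C;p)=N^*_-(\lambda,q)$, where $$N^*_-(\lambda,q)=\frac{\#Z_{GL_{|\lambda|}(\mathbb{F}_q)}(N_\lambda)}{\#Z_{GL_{|\mu|}(\mathbb{F}_{q^2})}(N_\mu)}.$$ (3) If $f(x)=x$ (so that $C$ is nilpotent), let now $k$ denote the size of the largest block in the Jordan normal form of $C$, let $r_j$ be the number of blocks of size $j\times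 j$ in the Jordan normal form of $C$ ($j=1,\dots,k$), and let $d_j=r_j+r_{j+1}+\dots+r_k$ (so $r_j=d_j-d_{j+1}$ with $d_{k+1}:=0$). Then $$N^*(C,C;p)=p^{\sum_{j=1}^k d_j^2}\prod_{j=1}^k\prod_{t=1}^{r_j}\left(1-\frac1{p^{t}}\right).$$
   Context: $N^*(C,C;p)=\#\{X\in GL_m(\mathbb{F}_p)\mid CX=X^{-1}C\}$. Quadratic residue symbol: for irreducible $f\in\mathbb{F}_p[x]$ and $g\in \mathbb{F}_p[x]$, $\left(\frac{g(x)}{f(x)}\right)$ equals $1$ if $g$ is a non-zero square in $\mathbb{F}_p[x]/(f)$, $-1$ if $g$ is not a square in $\mathbb{F}_p[x]/(f)$, and $0$ if $f\mid g$. A partition is a finite multiset $\lambda=[n_1,\dots,n_s]$ of positive integers, written in non-increasing order, $|\lambda|=n_1+\dots+n_s$. The dual partition $\lambda'=[d_1,d_2,\dots]$ has $d_j=$ the number of parts of $\lambda$ that are $\ge j$. For partitions $\mu,\nu$, $\mu+\nu$ denotes their join, i.e. the partition whose multiset of parts is the multiset union (with multiplicities added) of the parts of $\mu$ and $\nu$. $N_\lambda$ is a nilpotent $|\lambda|\times|\lambda|$ matrix with Jordan blocks of sizes $n_1,\dots,n_s$, and $Z_{GL_{|\lambda|}(F)}(N_\lambda)$ is its centralizer in $GL_{|\lambda|}(F)$ ($F$ a finite field); for the empty partition this group is trivial, of order $1$. *)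

(* Defs.v *)
From HB Require Import structures.
From mathcomp Require Import all_boot all_order all_algebra.

Set Implicit Arguments.
Unset Strict Implicit.
Unset Printing Implicit Defensive.

Import GRing.Theory.
Local Open Scope ring_scope.

(* A partition (a finite multiset of positive integers) is represented by the *)
(* non-increasing list of its parts, so that equality of multisets is Leibniz *)
(* equality; the empty partition is [::].                                     *)
Definition is_partition (la : seq nat) : bool :=
  sorted geq la && all (leq 1) la.

Definition join_part (mu nu : seq nat) : seq nat := sort geq (mu ++ nu).

Definition max_part (la : seq nat) : nat := (\max_(n <- la) n)%N.

(* The dual partition, without its trailing zeros. *)
Definition dual_part (la : seq nat) : seq nat :=
  [seq count (leq j) la | j <- iota 1 (max_part la)].

(* All ordered pairs (mu, nu) of partitions with mu + nu = la, each of them   *)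
(* once (see mem_splits): mu keeps the parts of la selected by a bit mask,    *)
(* and undup identifies the masks which select the same parts.                *)
Definition splits (la : seq nat) : seq (seq nat * seq nat) :=
  undup [seq (mask (val b) la, mask (map negb (val b)) la)
            | b <- enum {: (size la).-tuple bool}].

Lemma geq_total : total geq.
Proof. by move=> m n; exact: leq_total. Qed.

Lemma geq_trans : transitive geq.
Proof. by move=> m n p mn np; exact: leq_trans np mn. Qed.

Lemma geq_anti : antisymmetric geq.
Proof. by move=> m n mn; apply/eqP; rewrite eqn_leq andbC. Qed.

Lemma join_partE la mu nu : sorted geq la ->
  (join_part mu nu == la) = perm_eq (mu ++ nu) la.
Proof.
move=> sla; apply/eqP/idP => [<-|peq]; first by rewrite perm_sym perm_sort.
rewrite /join_part -[RHS](sorted_sort geq_trans sla).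
by apply/perm_sortP => //; [exact: geq_total|exact: geq_trans|exact: geq_anti].
Qed.

Lemma perm_mask_negb (T : eqType) (s : seq T) (b : bitseq) :
  size b = size s -> perm_eq (mask b s ++ mask (map negb b) s) s.
Proof.
elim: s b => [|x s IHs] [|[] b] //= [eqs]; first by rewrite perm_cons IHs.
by rewrite perm_catC /= perm_cons perm_catC IHs.
Qed.

Lemma split_mask la mu nu : sorted geq la -> sorted geq mu -> sorted geq nu ->
  perm_eq (mu ++ nu) la ->
  exists2 b, size b = size la & mu = mask b la /\ nu = mask (map negb b) la.
Proof.
elim: la mu nu => [|x la IH] mu nu sla smu snu peq.
  move: (perm_size peq) => /eqP; rewrite size_cat addn_eq0 => /andP[].
  by move=> /nilP-> /nilP->; exists [::].
have max_x y : y \in x :: la -> (y <= x)%N.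
  rewrite inE => /predU1P[-> //|yla].
  by have /allP := order_path_min geq_trans sla; apply.
have head_x s : {subset s <= x :: la} -> sorted geq s -> x \in s ->
    exists s', s = x :: s'.
  case: s => [|y s] //= sub ys xs; exists s; congr (_ :: _).
  apply/eqP; rewrite eqn_leq max_x ?sub ?mem_head //=.
  move: xs; rewrite inE => /predU1P[-> //|xs].
  by have /allP := order_path_min geq_trans ys; apply.
have sub_mu : {subset mu <= x :: la}.
  by move=> y ymu; rewrite -(perm_mem peq) mem_cat ymu.
have sub_nu : {subset nu <= x :: la}.
  by move=> y ynu; rewrite -(perm_mem peq) mem_cat ynu orbT.
have sla' : sorted geq la := path_sorted sla.
have : x \in mu ++ nu by rewrite (perm_mem peq) mem_head.
rewrite mem_cat => /orP[/(head_x _ sub_mu smu)|/(head_x _ sub_nu snu)] [s' def].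
  rewrite def in smu peq *; move: peq; rewrite cat_cons perm_cons => peq.
  have [b sb [-> ->]] := IH _ _ sla' (path_sorted smu) snu peq.
  by exists (true :: b); rewrite /= ?sb.
rewrite def in snu peq *; move: peq; rewrite perm_catC cat_cons perm_cons.
rewrite perm_catC => peq.
have [b sb [-> ->]] := IH _ _ sla' smu (path_sorted snu) peq.
by exists (false :: b); rewrite /= ?sb.
Qed.

Lemma mem_splits la mu nu : is_partition la ->
  ((mu, nu) \in splits la) =
    [&& is_partition mu, is_partition nu & join_part mu nu == la].
Proof.
move=> /andP[sla pla]; rewrite (join_partE _ _ sla) mem_undup.
apply/mapP/idP => [[b _ [-> ->]]|/and3P[/andP[smu _] /andP[snu _] peq]].
  rewrite /is_partition !(sorted_mask geq_trans) // perm_mask_negb ?size_tuple //.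
  by rewrite !andbT /=; apply/andP; split; apply/allP => n /mem_mask; apply/allP.
have [b sb [-> ->]] := split_mask sla smu snu peq.
by exists (Tuple (introT eqP sb)); rewrite ?mem_enum.
Qed.

Lemma splits_uniq la : uniq (splits la).
Proof. exact: undup_uniq. Qed.

Definition part_size (la : seq nat) (i : 'I_(size la)) : nat := nth 0%N la i.

(* N_la: block diagonal, with superdiagonal Jordan blocks of sizes la. *)
Definition nilp_mx (R : nzRingType) (la : seq nat) :
    'M[R]_(\sum_i @part_size la i) :=
  \mxdiag_(i < size la) \matrix_(a < part_size i, b < part_size i)
    (b == a.+1 :> nat)%:R.

(* #Z_GL(N_la). The set of invertible matrices is used instead of the library *)
(* group 'GL_n[F], which is not the trivial group when n = 0.                 *)
Definition card_cent (F : finFieldType) (la : seq nat) : nat :=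
  #|[set X : 'M[F]_(\sum_i @part_size la i) |
      (X \in unitmx) && (X *m nilp_mx F la == nilp_mx F la *m X)]|.

(* F is the field with q elements. *)
Definition Nplus (F : finFieldType) (la : seq nat) : rat :=
  \sum_(mn <- splits la)
    (card_cent F la)%:R / ((card_cent F mn.1)%:R * (card_cent F mn.2)%:R).

(* F is the field with q elements, F2 the field with q ^ 2 elements, and      *)
(* la = mu + mu.                                                              *)
Definition Nminus (F F2 : finFieldType) (la mu : seq nat) : rat :=
  (card_cent F la)%:R / (card_cent F2 mu)%:R.

Definition Nstar (F : finFieldType) (m : nat) (C : 'M[F]_m) : nat :=
  #|[set X : 'M[F]_m | (X \in unitmx) && (C *m X == invmx X *m C)]|.

(* The residue classes modulo f are represented by the polynomials of degree  *)
(* less than deg f.                                                           *)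
Definition residue_symbol (F : finFieldType) (g f : {poly F}) : int :=
  if f %| g then 0
  else if [exists h : {poly_(size f).-1 F}, f %| g - (h : {poly F}) ^+ 2]
  then 1 else -1.

(* la is the partition of m / deg f whose dual partition [d_1, ..., d_k]      *)
(* satisfies dim ker f(A)^j = (deg f) (d_1 + ... + d_j) for 1 <= j <= k. Here *)
(* kermx is the left kernel, which has the same dimension as the right one.   *)
Definition kernel_partition (F : fieldType) (n : nat) (A : 'M[F]_n.+1)
    (f : {poly F}) (k : nat) (la : seq nat) : Prop :=
  let d := (size f).-1 in
  [/\ is_partition la,
      (d * sumn la = n.+1)%N,
      size (dual_part la) = k
    & forall j : nat, (1 <= j <= k)%N ->
        \rank (kermx (horner_mx A f ^+ j)) =
          (d * \sum_(1 <= i < j.+1) nth 0 (dual_part la) i.-1)%N].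

(* The Jordan normal form of C is nilpotent, with blocks of sizes ka. *)
Definition jordan_partition (F : fieldType) (n : nat) (C : 'M[F]_n)
    (ka : seq nat) : Prop :=
  is_partition ka /\
  exists e : (\sum_i @part_size ka i)%N = n,
    C ~_{in unitmx} castmx (e, e) (nilp_mx F ka).

Definition Nnilp (p : nat) (ka : seq nat) : rat :=
  let k := max_part ka in
  let r j := count_mem j ka in
  let d j := (\sum_(j <= i < k.+1) r i)%N in
  p%:R ^+ (\sum_(1 <= j < k.+1) d j ^ 2)%N *
  \prod_(1 <= j < k.+1) \prod_(1 <= t < (r j).+1) (1 - 1 / p%:R ^+ t).

(* Main.v *)
Require Import Defs.
From mathcomp Require Import all_boot all_order all_algebra.
From mathcomp Require Import all_field zify ring.

Set Implicit Arguments.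
Unset Strict Implicit.
Unset Printing Implicit Defensive.

Import GRing.Theory.
Local Open Scope ring_scope.

(** If C is invertible, X |-> C X carries the solutions of C X = X^-1 C to the
    square roots D of A = C^2, and these all commute with A. So the first two
    cases count the square roots of a matrix whose minimal polynomial is f^k.

    Let Q be a large power of q = p^d. As f divides X^Q - X exactly once and
    f(X^Q) = f(X)^Q, the matrix S = A^Q satisfies f(S) = 0, and A - S is f(A)
    times a unit. Through S the space F_p^n becomes a vector space over F_q, on
    which A acts as alpha + N with alpha a root of f and N nilpotent, and the
    matrices that commute with A become the matrices over F_q that commute
    with N. Putting N in Jordan form, whose block sizes are read off the ranks
    of its powers, yields the partition lambda ([primary_model_exists],
    [model_transfer], [model_kernel_partition]).

    If x is a square modulo f, then alpha + N has a square root s which is a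
    polynomial in N, and D |-> s^-1 D turns the square roots of alpha + N into
    the involutions that commute with N. An involution is a decomposition of
    the space into two N-stable summands, of Jordan types mu and nu with
    mu + nu = lambda; those of given types form one orbit of the centralizer
    of N, whose stabilizer is the product of the two centralizers
    ([card_involutions]).

    If x is not a square modulo f, then g(x) = f(x^2) is irreducible, and the
    description above applies to each square root D of A with g instead of f,
    over the field with q^2 elements. As g(D) = f(A), the Jordan type mu of D
    satisfies lambda = mu + mu, so that it does not depend on D. Hence all the
    D are conjugate under the centralizer of A, and the stabilizer of D is the
    centralizer of D ([models_conjugate], [card_conjugate_roots]).

    If f = x, then C is nilpotent. Let Z be the restriction of C to its image.
    Restricting to the image maps the solutions X for C onto the solutions for
    Z, all fibres being of the same size, which depends only on the ranks of C
    and of C^2. Induction gives the product formula ([Nstar_nilpotent]). *)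

(** * Partitions through their tail sums *)

(** The number of cells of the Young diagram of la outside its first j columns.
    It is the rank of the j-th power of a nilpotent matrix with Jordan blocks of
    sizes la, which makes it the handiest form of the dual partition here. *)
Definition part_tail (la : seq nat) (j : nat) : nat := (\sum_(x <- la) (x - j))%N.

(** The (j+1)-st column has one cell for each part greater than j. *)
Lemma part_tailS la j :
  part_tail la j = (count (leq j.+1) la + part_tail la j.+1)%N.
Proof.
rewrite /part_tail; elim: la => [|x la IH]; first by rewrite !big_nil.
by rewrite !big_cons IH /=; lia.
Qed.

Lemma part_tail0 la : part_tail la 0 = sumn la.
Proof. by rewrite /part_tail sumnE; apply: eq_bigr => x _; rewrite subn0. Qed.

Lemma part_tail_cat la mu j :
  part_tail (la ++ mu) j = (part_tail la j + part_tail mu j)%N.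
Proof. by rewrite /part_tail big_cat. Qed.

Lemma part_tail_cons x la j :
  part_tail (x :: la) j = (x - j + part_tail la j)%N.
Proof. by rewrite /part_tail big_cons. Qed.

Lemma perm_part_tail la mu : perm_eq la mu -> part_tail la =1 part_tail mu.
Proof. by move=> peq j; apply: perm_big. Qed.

Lemma part_tail_eq0 la j : (part_tail la j == 0%N) = all (leq^~ j) la.
Proof.
by elim: la => [|x la IH]; rewrite /part_tail ?big_nil // big_cons addn_eq0 IH.
Qed.

Lemma count_leqS (s : seq nat) x :
  count (leq x) s = (count_mem x s + count (leq x.+1) s)%N.
Proof.
by elim: s => //= y s ->; rewrite /= addnACA; congr addn; case: ltngtP => /=.
Qed.

(** Successive differences of these counts are the multiplicities of the parts;
    the positivity of the parts settles the multiplicity of 0. *)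
Lemma count_leq_perm la mu : all (leq 1) la -> all (leq 1) mu ->
  (forall j, count (leq j.+1) la = count (leq j.+1) mu) -> perm_eq la mu.
Proof.
have c0 (s : seq nat) : all (leq 1) s -> count_mem 0%N s = 0%N.
  by elim: s => //= y s IH /andP[y0 /IH ->]; case: y y0.
move=> la1 mu1 cE; apply/allP => -[|x] _ /=; first by rewrite !c0.
by have := cE x; rewrite (count_leqS la) (count_leqS mu) cE => /addIn ->.
Qed.

Lemma partition_count_inj la mu : is_partition la -> is_partition mu ->
  (forall j, count (leq j.+1) la = count (leq j.+1) mu) -> la = mu.
Proof.
move=> /andP[sla la1] /andP[smu mu1] cE.
exact: (sorted_eq geq_trans geq_anti sla smu (count_leq_perm la1 mu1 cE)).
Qed.

Lemma partition_tail_inj la mu : is_partition la -> is_partition mu ->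
  part_tail la =1 part_tail mu -> la = mu.
Proof.
move=> pla pmu tE; apply: partition_count_inj => // j.
by have := part_tailS la j; rewrite !tE part_tailS => /addIn.
Qed.

Lemma join_part_tail la mu nu : is_partition la ->
  (forall j, part_tail la j = part_tail mu j + part_tail nu j)%N ->
  all (leq 1) mu -> all (leq 1) nu -> la = join_part mu nu.
Proof.
move=> pla tE mu1 nu1; apply: partition_tail_inj => //.
  by rewrite /is_partition (sort_sorted geq_total) all_sort all_cat mu1.
by move=> j; rewrite tE -part_tail_cat; apply/perm_part_tail; rewrite perm_sym perm_sort.
Qed.

Lemma max_part_leq la j : (max_part la <= j)%N = all (leq^~ j) la.
Proof.
rewrite /max_part; elim: la => [|x la IH]; first by rewrite big_nil.
by rewrite big_cons geq_max IH.
Qed.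

Lemma nth_dual_part la j : nth 0%N (dual_part la) j = count (leq j.+1) la.
Proof.
rewrite /dual_part; have [jm|mj] := ltnP j (max_part la).
  by rewrite (nth_map 0%N) ?size_iota // nth_iota.
rewrite nth_default ?size_map ?size_iota //; apply/esym/eqP; rewrite -leqn0.
rewrite leqNgt -has_count; apply/hasPn => x xla; rewrite -leqNgt.
by move: mj; rewrite max_part_leq => /allP; apply.
Qed.

Lemma size_dual_part la : size (dual_part la) = max_part la.
Proof. by rewrite size_map size_iota. Qed.

Lemma sum_dual_part la j :
  (\sum_(1 <= i < j.+1) nth 0 (dual_part la) i.-1 + part_tail la j = sumn la)%N.
Proof.
elim: j => [|j IH]; first by rewrite big_geq // part_tail0.
by rewrite big_nat_recr //= nth_dual_part -addnA -part_tailS.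
Qed.

(** * Isomorphisms between endomorphisms of different spaces *)

(** P is the matrix, acting on row vectors, of an isomorphism that carries A to
    B. A rectangular P lets m and n be equal without being syntactically so, as
    happens with sums of block sizes. *)
Definition isom_mx (F : fieldType) m n (A : 'M[F]_m) (B : 'M[F]_n)
    (P : 'M[F]_(m, n)) : bool :=
  [&& row_free P, row_full P & P *m B == A *m P].

Section Isom.
Variable F : fieldType.

Lemma isom_mx_dim m n (A : 'M[F]_m) (B : 'M_n) P : isom_mx A B P -> m = n.
Proof. by case/and3P=> /eqP rm /eqP rn _; rewrite -[LHS]rm rn. Qed.

Lemma isom_mxE n (A B P : 'M[F]_n) :
  isom_mx A B P = (P \in unitmx) && (P *m B == A *m P).
Proof. by rewrite /isom_mx row_free_unit row_full_unit; case: (P \in _). Qed.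

Lemma isom_mx_trans l m n (A : 'M[F]_l) (B : 'M_m) (C : 'M_n) P Q :
  isom_mx A B P -> isom_mx B C Q -> isom_mx A C (P *m Q).
Proof.
move=> iP iQ; have e1 := isom_mx_dim iP; have e2 := isom_mx_dim iQ.
move: e1 e2 => e1 e2; subst m; subst n.
move: iP iQ; rewrite !isom_mxE => /andP[uP /eqP PE] /andP[uQ /eqP QE].
by rewrite unitmx_mul uP uQ /= -mulmxA QE mulmxA PE mulmxA.
Qed.

Lemma isom_mx_sym m n (A : 'M[F]_m) (B : 'M_n) P :
  isom_mx A B P -> exists Q, isom_mx B A Q.
Proof.
move=> iP; have e := isom_mx_dim iP; subst n; exists (invmx P).
move: iP; rewrite !isom_mxE unitmx_inv => /andP[uP /eqP PE]; rewrite uP /=.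
by rewrite -[invmx P *m A](mulmxK uP) -(mulmxA _ A) -PE mulmxA mulVmx // mul1mx.
Qed.

Lemma exprM_intertwine m n (A : 'M[F]_m) (B : 'M_n) (P : 'M_(m, n)) j :
  P *m B = A *m P -> P *m (B ^+ j) = (A ^+ j) *m P.
Proof.
move=> PE; elim: j => [|j IH]; first by rewrite !expr0 mulmx1 mul1mx.
by rewrite !exprS -!mulmxE mulmxA PE -mulmxA IH mulmxA.
Qed.

Lemma isom_mx_rankX m n (A : 'M[F]_m) (B : 'M_n) P j :
  isom_mx A B P -> \rank (A ^+ j) = \rank (B ^+ j).
Proof.
move=> /and3P[fP uP /eqP/exprM_intertwine PE].
by rewrite -(mxrankMfree _ fP) -PE eqmxMfull.
Qed.

Lemma isom_mx_cast m n (e : m = n) (A : 'M[F]_m) :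
  exists P, isom_mx A (castmx (e, e) A) P.
Proof.
by subst n; exists 1%:M; rewrite castmx_id isom_mxE unitmx1 mulmx1 mul1mx eqxx.
Qed.

Lemma isom_mx_block m1 m2 n1 n2 (A1 : 'M[F]_m1) (A2 : 'M_m2) (B1 : 'M_n1)
    (B2 : 'M_n2) P1 P2 : isom_mx A1 B1 P1 -> isom_mx A2 B2 P2 ->
  isom_mx (block_mx A1 0 0 A2) (block_mx B1 0 0 B2) (block_mx P1 0 0 P2).
Proof.
move=> iP iQ; have e1 := isom_mx_dim iP; have e2 := isom_mx_dim iQ.
subst n1; subst n2; move: iP iQ.
rewrite !isom_mxE => /andP[uP /eqP PE] /andP[uQ /eqP QE].
rewrite !unitmxE det_ublock unitrM -!unitmxE uP uQ /=.
by rewrite !mulmx_block !(mulmx0, mul0mx, addr0, add0r) PE QE.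
Qed.

Lemma block_diagX m n (A : 'M[F]_m) (B : 'M_n) j :
  block_mx A 0 0 B ^+ j = block_mx (A ^+ j) 0 0 (B ^+ j).
Proof.
elim: j => [|j IH]; first by rewrite !expr0 -scalar_mx_block.
rewrite !exprS IH -!mulmxE mulmx_block.
by rewrite !(mulmx0, mul0mx, addr0, add0r).
Qed.

Lemma rank_block_diagX m n (A : 'M[F]_m) (B : 'M_n) j :
  \rank (block_mx A 0 0 B ^+ j) = (\rank (A ^+ j) + \rank (B ^+ j))%N.
Proof. by rewrite block_diagX rank_diag_block_mx. Qed.

Definition jordan_block x : 'M[F]_x := \matrix_(a, b) (b == a.+1 :> nat)%:R.

Lemma jordan_blockX x j :
  jordan_block x ^+ j = \matrix_(a, b) (b == a + j :> nat)%N%:R.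
Proof.
elim: j => [|j IH].
  apply/matrixP=> a b; rewrite expr0 !mxE addn0.
  by rewrite eq_sym; congr (_%:R).
apply/matrixP=> a b; rewrite exprSr IH -mulmxE !mxE.
have [abx|abx] := ltnP (a + j) x.
  rewrite (bigD1 (Ordinal abx)) //= !mxE eqxx mul1r addnS big1 ?addr0 //.
  by move=> c; rewrite -val_eqE /= !mxE => /negPf ->; rewrite mul0r.
rewrite big1 => [|c _]; first by case: eqP => // E; have := ltn_ord b; lia.
by rewrite !mxE; case: eqP => [E|]; rewrite ?mul0r //; have := ltn_ord c; lia.
Qed.

(** The j-th power factors as the projection to the first x - j coordinates
    followed by an injective shift. *)
Lemma rank_jordan_blockX x j : \rank (jordan_block x ^+ j) = (x - j)%N.
Proof.
pose B : 'M[F]_(x - j, x) := \matrix_(c, b) (b == c + j :> nat)%N%:R.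
have -> : jordan_block x ^+ j = (pid_mx (x - j) : 'M_(x, x - j)) *m B.
  apply/matrixP=> a b; rewrite jordan_blockX !mxE.
  have [ax|ax] := ltnP a (x - j).
    rewrite (bigD1 (Ordinal ax)) //= !mxE eqxx ax mul1r big1 ?addr0 //.
    by move=> c; rewrite -val_eqE /= eq_sym !mxE => /negPf ->; rewrite mul0r.
  rewrite big1 => [|c _]; first by case: eqP => // E; have := ltn_ord b; lia.
  by rewrite !mxE [(a < _)%N]ltnNge ax andbF mul0r.
rewrite mxrankMfree ?rank_pid_mx ?leq_subr //.
apply/row_freeP; exists B^T; apply/matrixP=> c c'; rewrite !mxE.
have cx : (c + j < x)%N by have := ltn_ord c; lia.
rewrite (bigD1 (Ordinal cx)) //= !mxE eqxx mul1r big1 ?addr0.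
  by rewrite eqn_add2r.
by move=> b; rewrite -val_eqE /= !mxE => /negPf ->; rewrite mul0r.
Qed.

Lemma nilp_mx_cons x la : exists P,
  isom_mx (nilp_mx F (x :: la)) (block_mx (jordan_block x) 0 0 (nilp_mx F la)) P.
Proof.
rewrite /nilp_mx mxdiag_recl; set e := mxsize_recl.
have [P iP] := isom_mx_cast (esym e)
 (castmx (e, e) (block_mx (jordan_block x) 0 0 (nilp_mx F la))).
by exists P; move: iP; rewrite castmx_comp /= castmx_id.
Qed.

Lemma rank_nilp_mxX la j : \rank (nilp_mx F la ^+ j) = part_tail la j.
Proof.
elim: la => [|x la IH].
  rewrite /part_tail big_nil; apply/eqP; rewrite -leqn0.
  by apply: (leq_trans (rank_leq_row _)); rewrite big_ord0.
have [P iP] := nilp_mx_cons x la.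
by rewrite (isom_mx_rankX _ iP) rank_block_diagX IH rank_jordan_blockX part_tail_cons.
Qed.

Lemma nilp_mx_exp_max_part la : nilp_mx F la ^+ max_part la = 0.
Proof.
by apply/eqP; rewrite -mxrank_eq0 rank_nilp_mxX part_tail_eq0 -max_part_leq.
Qed.

Lemma size_nilp_mx la : (\sum_i @part_size la i)%N = sumn la.
Proof. by rewrite sumnE (big_nth 0%N) big_mkord. Qed.

End Isom.

(** * The Jordan form of a nilpotent matrix *)

Section Jordan.
Variable F : fieldType.

(** Choose an entry (i, j) at which N^k does not vanish. The rows i of the powers
    N^0, ..., N^k span a Jordan block; the common kernel of the columns j of
    these powers is N-stable, and it is a complement of the block because the
    Hankel matrix of the pairings, (N^(a+b))_ij, is triangular with nonzero
    antidiagonal. *)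
Lemma split_off_jordan_block n (N : 'M[F]_n) k :
  N ^+ k.+1 = 0 -> N ^+ k != 0 ->
  exists (r : nat) (N' : 'M[F]_r) P, [/\ (r < n)%N, N' ^+ k.+1 = 0 &
    isom_mx (block_mx (jordan_block F k.+1) 0 0 N') N P].
Proof.
move=> Nk1 Nk.
have /existsP[i /existsP[j Nij]] : [exists i, exists j, (N ^+ k) i j != 0].
  apply: contraNT Nk => /existsPn /= NN0.
  apply/eqP/matrixP=> i j; rewrite mxE; apply/eqP.
  by have /existsPn /(_ j) := NN0 i; rewrite negbK.
pose R : 'M[F]_(k.+1, n) := \matrix_a row i (N ^+ a).
pose Cm : 'M[F]_(n, k.+1) := \matrix_(a, b) (N ^+ b) a j.
have N0 a : (k < a)%N -> N ^+ a = 0.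
  by move=> ka; rewrite -(subnK ka) exprD Nk1 mulr0.
have RCE (a b : 'I_k.+1) : (R *m Cm) a b = (N ^+ (a + b)) i j.
  rewrite exprD -mulmxE !mxE; apply: eq_bigr => c _.
  by rewrite !mxE.
have RN : R *m N = jordan_block F k.+1 *m R.
  apply/row_matrixP=> a; rewrite !row_mul rowK.
  have -> : row i (N ^+ a) *m N = row i (N ^+ a.+1).
    by rewrite -row_mul exprSr mulmxE.
  have [ak|ak] := ltnP a.+1 k.+1.
    have -> : row a (jordan_block F k.+1) = delta_mx 0 (Ordinal ak).
      by apply/rowP=> b; rewrite !mxE eqxx.
    by rewrite -rowE rowK.
  have -> : row a (jordan_block F k.+1) = 0.
    by apply/rowP=> b; rewrite !mxE ltn_eqF // (leq_trans (ltn_ord b)).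
  by rewrite mul0mx N0 // row0.
have RCinj (u : 'rV_k.+1) : u *m (R *m Cm) = 0 -> u = 0.
  move=> uH; apply/eqP; apply/negPn/negP => u0.
  have [a0 ua0] : exists a, u 0 a != 0.
    apply/existsP; apply: contraNT u0 => /existsPn u0.
    by apply/eqP/rowP=> a; rewrite mxE; apply/eqP; rewrite -[_ == _]negbK.
  (* the first nonzero coordinate a of u is detected by column k - a *)
  case: (@arg_minnP _ a0 (fun a => u 0 a != 0) (@nat_of_ord _) ua0) => a ua amin.
  have ka : (k - a < k.+1)%N by lia.
  move/rowP: uH => /(_ (Ordinal ka)); rewrite mxE (bigD1 a) //= big1.
    rewrite addr0 RCE /= subnKC -1?ltnS // mxE => /eqP.
    by rewrite mulf_eq0 (negPf ua) (negPf Nij).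
  move=> c ca; rewrite RCE /=.
  have [ac|ca'] := ltnP a c.
    by rewrite N0 ?mxE ?mulr0 //; have := ltn_ord a; lia.
  have [->|/amin] := eqVneq (u 0 c) 0; first by rewrite mul0r.
  by move=> ac; case/negP: ca; apply/eqP/val_inj/eqP; rewrite eqn_leq ca' ac.
have fH : row_free (R *m Cm).
  rewrite -kermx_eq0; apply/eqP/row_matrixP => a; rewrite row0.
  by apply: RCinj; rewrite -row_mul mulmx_ker row0.
have rCm : \rank Cm = k.+1.
  apply/eqP; rewrite eqn_leq rank_leq_col.
  by rewrite -{1}(eqP fH) mxrankM_maxr.
pose K := row_base (kermx Cm); pose N' := K *m N *m pinvmx K.
have KC : K *m Cm = 0 by apply/sub_kermxP; rewrite eq_row_base.
have KN : K *m N = N' *m K.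
  rewrite mulmxKpV // eq_row_base; apply/sub_kermxP.
  have -> : K *m N *m Cm = K *m (N *m Cm) by rewrite mulmxA.
  suff cE b : col b (K *m (N *m Cm)) = 0.
    apply/matrixP => x b; have := congr1 (fun M : 'cV_ _ => M x 0) (cE b).
    by rewrite mxE => ->; rewrite !mxE.
  have colM x y z (A : 'M[F]_(x, y)) (B : 'M_(y, z)) c : col c (A *m B) = A *m col c B.
    by rewrite !colE mulmxA.
  rewrite colM.
  have [bk|bk] := ltnP b.+1 k.+1.
    have -> : col b (N *m Cm) = col (Ordinal bk) Cm.
      apply/colP => c; rewrite !mxE exprS -mulmxE mxE.
      by apply: eq_bigr => d _; rewrite !mxE.
    by rewrite -colM KC col0.
  have -> : col b (N *m Cm) = 0.
    have bE : (b : nat) = k by have := ltn_ord b; lia.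
    apply/colP => c; transitivity ((N ^+ b.+1) c j).
      by rewrite exprS -mulmxE !mxE; apply: eq_bigr => d _; rewrite !mxE.
    by rewrite bE N0 ?mxE.
  by rewrite mulmx0.
have fK : row_free K by rewrite row_base_free.
have fP : row_free (col_mx R K).
  rewrite -kermx_eq0; apply/eqP/row_matrixP => a; rewrite row0.
  have: row a (kermx (col_mx R K)) *m col_mx R K = 0.
    by rewrite -row_mul mulmx_ker row0.
  rewrite -[row a _]hsubmxK mul_row_col => E.
  have u0 : lsubmx (row a (kermx (col_mx R K))) = 0.
    apply: RCinj; have /= := congr1 (mulmx^~ Cm) E.
    rewrite mulmxDl mul0mx -[_ *m K *m _]mulmxA KC mulmx0 addr0.
    by rewrite -mulmxA.
  move: E; rewrite u0 mul0mx add0r => /eqP; rewrite (mulmx_free_eq0 _ fK).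
  by move=> /eqP ->; rewrite row_mx0.
have kn : (k.+1 <= n)%N by rewrite -rCm rank_leq_row.
have rK : \rank (kermx Cm) = (n - k.+1)%N by rewrite mxrank_ker rCm.
exists (\rank (kermx Cm)), N', (col_mx R K); split; first by rewrite rK; lia.
  apply/(row_free_inj fK); rewrite mul0mx.
  by rewrite -(exprM_intertwine _ KN) Nk1 mulmx0.
have uP : row_full (col_mx R K) by rewrite /row_full (eqP fP) [in X in (_ + X)%N]rK subnKC.
rewrite /isom_mx fP uP /=.
by rewrite mul_block_col mul_col_mx RN KN !mul0mx addr0 add0r.
Qed.

(** Splitting off a block of maximal size first makes the sizes come out in
    non-increasing order. *)
Lemma jordan_form n (N : 'M[F]_n) k : N ^+ k = 0 ->
  exists la P, is_partition la /\ isom_mx (nilp_mx F la) N P.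
Proof.
elim/ltn_ind: n => n IH in N k *.
have [n0 _|n_gt0] := posnP n.
  subst n; exists [::].
  have e : (\sum_i @part_size [::] i)%N = 0%N by rewrite size_nilp_mx.
  have [P iP] := isom_mx_cast e (nilp_mx F [::]); exists P; split=> //.
  by rewrite [N]flatmx0 -[0](flatmx0 (castmx (e, e) (nilp_mx F [::]))).
move=> Nk; have ex : exists k, N ^+ k == 0 by exists k; rewrite Nk.
case: (ex_minnP ex) => -[|k'] /eqP Nk1 kmin.
  have := mxrank1 F n; rewrite -[1%:M]/(N ^+ 0) Nk1 mxrank0 => n0.
  by rewrite -n0 in n_gt0.
have Nk' : N ^+ k' != 0 by apply/negP => /kmin; rewrite ltnn.
have [r [N' [P [rn N'k iP]]]] := split_off_jordan_block Nk1 Nk'.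
have [la [Q [pla iQ]]] := IH r rn N' _ N'k.
have [Q1 iQ1] := nilp_mx_cons F k'.+1 la.
have i1 : isom_mx (jordan_block F k'.+1) (jordan_block F k'.+1) 1%:M.
  by rewrite isom_mxE unitmx1 mulmx1 mul1mx eqxx.
have iR := isom_mx_trans (isom_mx_trans iQ1 (isom_mx_block i1 iQ)) iP.
exists (k'.+1 :: la); eexists; split; last exact: iR.
move: pla; rewrite /is_partition /= => /andP[sla ->]; rewrite andbT.
have : part_tail la k'.+1 = 0%N.
  by rewrite -(rank_nilp_mxX F) (isom_mx_rankX _ iQ) N'k mxrank0.
by move/eqP; rewrite part_tail_eq0 (path_sortedE geq_trans) sla andbT.
Qed.

(** The ranks of the powers are a complete invariant of a nilpotent matrix. *)
Lemma jordan_form_tail n (N : 'M[F]_n) la : is_partition la ->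
  (forall j, \rank (N ^+ j) = part_tail la j) ->
  exists P, isom_mx (nilp_mx F la) N P.
Proof.
move=> pla rN.
have [mu [P [pmu iP]]] : exists mu P, is_partition mu /\ isom_mx (nilp_mx F mu) N P.
  apply: (@jordan_form _ N (max_part la)); apply/eqP; rewrite -mxrank_eq0 rN.
  by rewrite part_tail_eq0 -max_part_leq.
suff -> : la = mu by exists P.
apply: partition_tail_inj => // j.
by rewrite -rN -(isom_mx_rankX _ iP) rank_nilp_mxX.
Qed.

End Jordan.

(** * The number of solutions for a nilpotent matrix *)

Section NilpotentCount.
Variable F : finFieldType.
Local Notation q := #|F|.

(** The proportion of invertible matrices among all r x r matrices. *)
Definition GL_factor r : rat := \prod_(1 <= t < r.+1) (1 - 1 / q%:R ^+ t).

Lemma card_field_gt0 : (0 < q)%N.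
Proof. by apply/card_gt0P; exists 0. Qed.

Lemma natr_card_field_neq0 : q%:R != 0 :> rat.
Proof. by rewrite Num.Theory.pnatr_eq0 -lt0n card_field_gt0. Qed.

Lemma card_unitmx r :
  #|[set X : 'M[F]_r | X \in unitmx]|%:R = q%:R ^+ (r ^ 2) * GL_factor r.
Proof.
have q0 := natr_card_field_neq0.
case: r => [|r].
  rewrite /GL_factor big_geq // mulr1 expr0.
  suff -> : [set X : 'M[F]_0 | X \in unitmx] = [set 0] by rewrite cards1.
  apply/setP=> X; rewrite !inE [X]flatmx0 eqxx.
  by rewrite unitmxE det_mx00 unitr1.
have <- : #|'GL_r.+1[F]%g| = #|[set X : 'M[F]_r.+1 | X \in unitmx]|.
  by rewrite cardsT /= card_sub; apply: eq_card => X; rewrite !inE.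
rewrite card_GL // natrM natrX natr_prod /GL_factor.
have -> : (r.+1 ^ 2 = 'C(r.+1, 2) + \sum_(1 <= i < r.+2) i)%N.
  elim: (r.+1) => [|m IH]; first by rewrite big_geq.
  by rewrite big_nat_recr //= binS bin1; lia.
rewrite exprD -mulrA; congr (_ * _).
rewrite expr_sum -big_split /= big_nat [RHS]big_nat; apply: eq_bigr => i /andP[i0 _].
rewrite natrB ?expn_gt0 ?card_field_gt0 //.
by rewrite natrX mulrBr mulr1 mul1r divff // expf_neq0.
Qed.

(** After a change of basis T2 is (0 1), and the upper left block of the
    completion decides whether it is invertible. *)
Lemma card_completions r s (T2 : 'M[F]_(s, r + s)) : row_free T2 ->
  #|[set H1 : 'M[F]_(r, r + s) | col_mx H1 T2 \in unitmx]| =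
  (#|[set X : 'M[F]_r | X \in unitmx]| * q ^ (r * s))%N.
Proof.
move=> fT.
pose U : 'M[F]_(s, r + s) := row_mx 0 1%:M.
have fU : row_free U.
  by apply/row_freeP; exists (col_mx 0 1%:M); rewrite mul_row_col mul0mx mul1mx add0r.
have UT : U *m col_mx 0 T2 = T2 by rewrite mul_row_col mul0mx mul1mx add0r.
have [|Q uQ QE] := @complete_unitmx F _ _ U (col_mx 0 T2).
  by rewrite UT (eqP fT) (eqP fU).
rewrite UT in QE.
rewrite -(@card_mx F r s) -cardsT -cardsX.
have inj : injective (fun ab : 'M[F]_r * 'M[F]_(r, s) => row_mx ab.1 ab.2 *m Q).
  move=> [a b] [a' b'] /= /(can_inj (mulmxK uQ)) E.
  by have [-> ->] := eq_row_mx E.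
rewrite -(card_imset _ inj); apply: eq_card => H; rewrite !inE.
have E a b : (col_mx (row_mx a b *m Q) T2 \in unitmx) = (a \in unitmx).
  rewrite QE -mul_col_mx unitmx_mul uQ andbT.
  rewrite -[col_mx _ _]/(block_mx a b 0 1%:M) !unitmxE det_ublock det1 mulr1.
  by [].
apply/idP/imsetP => [uH|[[a b]]]; last by rewrite !inE /= andbT => ua ->; rewrite E.
exists (lsubmx (H *m invmx Q), rsubmx (H *m invmx Q)) => /=.
  rewrite !inE andbT /= -(E _ (rsubmx (H *m invmx Q))) hsubmxK mulmxKV //.
by rewrite hsubmxK mulmxKV.
Qed.

Lemma card_affine_unit_block r s (T : 'M[F]_(r + s)) :
  row_free (row_mx T (pid_mx r : 'M_(r + s))) ->
  #|[set H : 'M[F]_(r + s) | T + pid_mx r *m H \in unitmx]| =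
  (#|[set X : 'M[F]_r | X \in unitmx]| * q ^ (r * s) * q ^ (s * (r + s)))%N.
Proof.
move=> fT.
have f2 : row_free (dsubmx T).
  rewrite -kermx_eq0; apply/eqP/row_matrixP => i; rewrite row0.
  set w := row i _; have wT : w *m dsubmx T = 0.
    by rewrite /w -row_mul mulmx_ker row0.
  have : row_mx 0 w *m row_mx T (pid_mx r : 'M_(r + s)) = 0.
    rewrite mul_mx_row -[T in X in row_mx X _]vsubmxK mul_row_col mul0mx wT.
    rewrite pid_mx_block mul_row_block !(mul0mx, mulmx0, addr0) row_mx0.
    by rewrite row_mx0.
  move/eqP; rewrite (mulmx_free_eq0 _ fT) => /eqP.
  by rewrite -[0 in X in _ = X]row_mx0 => /eq_row_mx[].
rewrite -(card_completions f2) -(@card_mx F s (r + s)) -cardsT -cardsX.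
pose g (H : 'M[F]_(r, r + s) * 'M[F]_(s, r + s)) := col_mx (H.1 - usubmx T) H.2.
have inj : injective g.
  by move=> [a b] [a' b']; rewrite /g /= => /eq_col_mx[/addIr -> ->].
rewrite -(card_imset _ inj); apply: eq_card => H; rewrite !inE.
have E a b : T + pid_mx r *m g (a, b) = col_mx a (dsubmx T).
  rewrite -[T in LHS]vsubmxK pid_mx_block mul_block_col !(mul0mx, mul1mx, addr0).
  by rewrite add_col_mx addr0 addrC subrK.
apply/idP/imsetP => [uH|[[a b]]]; last by rewrite !inE /= andbT => ua ->; rewrite E.
exists (usubmx H + usubmx T, dsubmx H); last by rewrite /g /= addrK vsubmxK.
by rewrite !inE andbT /= -(E _ (dsubmx H)) /g /= addrK vsubmxK.
Qed.

(** Only the rank of G matters: reducing G to a partial identity, H affects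
    T + G H through its first rank G rows, which are arbitrary, while the
    remaining rows of T + G H are fixed and independent by the hypothesis. *)
Lemma card_affine_unit s (T G : 'M[F]_s) : row_free (row_mx T G) ->
  #|[set H : 'M[F]_s | T + G *m H \in unitmx]|%:R =
  q%:R ^+ (s ^ 2) * GL_factor (\rank G).
Proof.
move=> fT; set r := \rank G.
have uA := col_ebase_unit G; have uB := row_ebase_unit G.
set A := col_ebase G in uA; set B := row_ebase G in uB.
have GE : G = A *m pid_mx r *m B by rewrite mulmx_ebase.
pose T' := invmx A *m T.
have fT' : row_free (row_mx T' (pid_mx r : 'M_s)).
  have -> : row_mx T' (pid_mx r) = invmx A *m row_mx T G *m block_mx 1%:M 0 0 (invmx B).
    rewrite mul_mx_row mul_row_block !(mulmx0, mulmx1, addr0, add0r) GE.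
    by rewrite !mulmxA mulVmx // mul1mx mulmxK.
  rewrite /row_free mxrankMfree; last first.
    rewrite row_free_unit unitmxE det_ublock det1 mul1r -unitmxE unitmx_inv //.
  by rewrite eqmxMfull // row_full_unit unitmx_inv.
have -> : #|[set H : 'M[F]_s | T + G *m H \in unitmx]| =
          #|[set H : 'M[F]_s | T' + pid_mx r *m H \in unitmx]|.
  have inj : injective (mulmx (invmx B) : 'M_s -> 'M_s).
    by move=> X Y /(can_inj (mulKmx (_ : invmx B \in unitmx))); apply; rewrite unitmx_inv.
  rewrite -[RHS](card_imset _ inj); apply: eq_card => H; rewrite !inE.
  have E H' : (T + G *m (invmx B *m H') \in unitmx) = (T' + pid_mx r *m H' \in unitmx).
    rewrite -[RHS]andTb -uA -unitmx_mul mulmxDr mulKVmx //.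
    by rewrite [in LHS]GE !mulmxA mulmxK.
  apply/idP/imsetP => [uH|[H']]; last by rewrite inE -E => ? ->.
  by exists (B *m H); rewrite ?inE -?E mulKmx.
have [d sE] : exists d, s = (r + d)%N.
  by exists (s - r)%N; rewrite subnKC // rank_leq_row.
clearbody r; clear - fT' sE; subst s.
rewrite (card_affine_unit_block fT') !natrM card_unitmx !natrX.
have -> : ((r + d) ^ 2 = r ^ 2 + r * d + d * (r + d))%N by lia.
by rewrite !exprD; ring.
Qed.

Lemma Nstar_isom m n (C : 'M[F]_m) (D : 'M[F]_n) P :
  isom_mx C D P -> Nstar C = Nstar D.
Proof.
move=> iP; have e := isom_mx_dim iP; subst n.
move: iP; rewrite isom_mxE => /andP[uP /eqP PE].
have DE : D = invmx P *m C *m P by rewrite -mulmxA -PE mulKmx.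
rewrite /Nstar.
have inj : injective (fun X : 'M[F]_m => invmx P *m X *m P).
  by move=> X Y /(can_inj (mulmxK uP)) /(can_inj (mulKmx (_ : invmx P \in unitmx)));
    apply; rewrite unitmx_inv.
have key (D' X : 'M[F]_m) : X \in unitmx ->
    (D' *m X == invmx X *m D') = (X *m D' *m X == D').
  move=> uX; rewrite -(inj_eq (can_inj (mulKmx uX))) mulKVmx //.
  by rewrite mulmxA.
rewrite -(card_imset _ inj); apply: eq_card => X; rewrite !inE.
have E X' : (invmx P *m X' *m P \in unitmx) &&
   (D *m (invmx P *m X' *m P) == invmx (invmx P *m X' *m P) *m D) =
   (X' \in unitmx) && (C *m X' == invmx X' *m C).
  rewrite !unitmx_mul unitmx_inv uP andbT /=.
  case uX: (X' \in unitmx) => //=.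
  rewrite !key ?unitmx_mul ?unitmx_inv ?uP ?uX //.
  rewrite -[RHS](inj_eq inj) /= DE !mulmxA !(mulmxK uP) //.
apply/imsetP/idP => [[X' X'S ->]|XS]; first by move: X'S; rewrite inE E.
have XE : X = invmx P *m (P *m X *m invmx P) *m P.
  by rewrite !mulmxA mulVmx // mul1mx mulmxKV.
by exists (P *m X *m invmx P); rewrite // inE -E -XE.
Qed.

(** Up to conjugation a matrix C of rank r is the product of the projection to
    the first r coordinates and of an invertible U. Its image is then spanned by
    (Z M), and Z is the matrix of C on its image. A solution X of X C X = C
    preserves the kernel of C, so it is block upper triangular with diagonal
    blocks a, d; here a is a solution for Z, and the last block column (b, d) is
    constrained by Z b + M d = a^-1 M. *)
Section Step.
Variables (r s : nat) (U : 'M[F]_(r + s)).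
Hypothesis uU : U \in unitmx.
Let V := invmx U.
Let Z := ulsubmx U.
Let M := ursubmx U.
Let C : 'M[F]_(r + s) := pid_mx r *m U.

Let UV : U *m V = 1%:M. Proof. exact: mulmxV. Qed.

Let R_free : row_free (row_mx Z M).
Proof.
apply/row_freeP; exists (lsubmx V).
rewrite hsubmxK; have := congr1 (fun A => ulsubmx A) UV.
by rewrite -[U in LHS]vsubmxK -[V in LHS]hsubmxK mul_col_row block_mxKul
           scalar_mx_block block_mxKul.
Qed.

Let CE : C = block_mx Z M 0 0.
Proof.
rewrite /C -[U in LHS]submxK pid_mx_block mulmx_block.
by rewrite !(mul1mx, mul0mx, addr0).
Qed.

(** The nullity theorem: complementary blocks of a matrix and of its inverse have
    the same nullity. *)
Lemma rank_drsubmx_invmx : (\rank (drsubmx V) + r = \rank Z + s)%N.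
Proof.
pose W := block_mx 1%:M (ursubmx V) 0 (drsubmx V).
have WE : U *m W = block_mx Z 0 (dlsubmx U) 1%:M.
  have -> : W = block_mx 1%:M 0 0 0 + V *m block_mx 0 0 0 1%:M.
    rewrite -[V in RHS]submxK mulmx_block add_block_mx.
    by rewrite !(mulmx1, mulmx0, add0r, addr0).
  rewrite mulmxDr mulmxA UV mul1mx -[U in LHS]submxK mulmx_block add_block_mx.
  by rewrite !(mulmx1, mulmx0, add0r, addr0).
have rW : \rank W = (r + \rank (drsubmx V))%N.
  have -> : W = block_mx 1%:M 0 0 (drsubmx V) *m block_mx 1%:M (ursubmx V) 0 1%:M.
    by rewrite mulmx_block !(mulmx1, mul1mx, mulmx0, mul0mx, add0r, addr0).
  rewrite mxrankMfree; first by rewrite rank_diag_block_mx mxrank1.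
  by rewrite row_free_unit unitmxE det_ublock !det1 mulr1 unitr1.
have rUW : \rank (U *m W) = (\rank Z + s)%N.
  have -> : U *m W = block_mx Z 0 0 1%:M *m block_mx 1%:M 0 (dlsubmx U) 1%:M.
    by rewrite WE mulmx_block !(mulmx1, mul1mx, mulmx0, mul0mx, add0r, addr0).
  rewrite mxrankMfree; first by rewrite rank_diag_block_mx mxrank1.
  by rewrite row_free_unit unitmxE det_lblock !det1 mulr1 unitr1.
by rewrite -rUW eqmxMfull ?row_full_unit // rW addnC.
Qed.

Lemma rank_pid_mulmx_exprS j : \rank (C ^+ j.+1) = \rank (Z ^+ j).
Proof.
pose E : 'M[F]_(r + s, r) := col_mx 1%:M 0.
have -> : C ^+ j.+1 = E *m Z ^+ j *m row_mx Z M.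
  have CE' : C = E *m row_mx Z M.
    by rewrite CE mul_col_row !(mul1mx, mul0mx).
  have RE : row_mx Z M *m E = Z by rewrite mul_row_col mulmx1 mulmx0 addr0.
  elim: j => [|j IH]; first by rewrite expr1 expr0 mulmx1.
  rewrite exprSr IH -mulmxE [in LHS]CE' !mulmxA -[_ *m row_mx Z M *m E]mulmxA RE.
  by rewrite exprSr -mulmxE mulmxA.
rewrite (mxrankMfree _ R_free) -mxrank_tr trmx_mul mxrankMfree ?mxrank_tr //.
rewrite /row_free mxrank_tr; have : \rank E = r; last by move->.
apply/eqP; rewrite eqn_leq rank_leq_col /= -{1}(mxrank1 F r).
have -> : 1%:M = row_mx 1%:M 0 *m E by rewrite mul_row_col mulmx1 mul0mx addr0.
exact: mxrankM_maxr.
Qed.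

(** The parameter X is the free part of U (b, d); the matrix required to be
    invertible is the block d. *)
Let lifts (a : 'M[F]_r) := [set X : 'M[F]_s | dlsubmx V *m invmx a *m M
  + drsubmx V *m X \in unitmx].

Let lift_mx (a : 'M[F]_r) (H : 'M[F]_s) : 'M[F]_(r + s) :=
  row_mx (col_mx a 0) (V *m col_mx (invmx a *m M) H).

Let solsC := [set X : 'M[F]_(r + s) | (X \in unitmx) && (C *m X == invmx X *m C)].
Let solsZ := [set a : 'M[F]_r | (a \in unitmx) && (Z *m a == invmx a *m Z)].

Let lift_mxE a H : lift_mx a H = block_mx a (usubmx (V *m col_mx (invmx a *m M) H)) 0
   (dlsubmx V *m invmx a *m M + drsubmx V *m H).
Proof.
rewrite /lift_mx block_mxEh; congr (row_mx _ _); rewrite -[LHS]vsubmxK.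
congr (col_mx _ _); rewrite -[V in LHS]submxK mul_block_col col_mxKd mulmxA.
by [].
Qed.

Let R_lift a H : row_mx Z M *m lift_mx a H = row_mx (Z *m a) (invmx a *m M).
Proof.
rewrite /lift_mx mul_mx_row mul_row_col mulmx0 addr0; congr (row_mx _ _).
rewrite hsubmxK mulmxA; have -> : usubmx U *m V = row_mx 1%:M 0.
  by rewrite mul_usub_mx UV scalar_mx_block block_mxEv col_mxKu.
by rewrite mul_row_col mul1mx mul0mx addr0.
Qed.

Let CRE (X : 'M_(r + s)) : C *m X = col_mx (row_mx Z M *m X) 0.
Proof. by rewrite CE block_mxEv mul_col_mx row_mx0 mul0mx. Qed.

Let solsCP (X : 'M_(r + s)) :
  reflect (exists a H, [/\ a \in solsZ, H \in lifts a & X = lift_mx a H])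
          (X \in solsC).
Proof.
apply: (iffP idP) => [|[a [H [aZ Hs ->]]]].
  rewrite inE => /andP[uX /eqP XE].
  have XCX : X *m C *m X = C by rewrite -mulmxA XE mulKVmx.
  have XC : X *m C = C *m invmx X by rewrite -{2}XCX mulmxK.
  set a := ulsubmx X; set b := ursubmx X; set d := drsubmx X.
  have c0 : dlsubmx X = 0.
    apply: (row_free_inj R_free); rewrite mul0mx.
    move/(congr1 dsubmx): XC; rewrite CRE col_mxKd CE -[X in LHS]submxK.
    rewrite mulmx_block !mulmx0 !addr0 block_mxEv col_mxKd => <-.
    by rewrite mul_mx_row.
  have XB : X = block_mx a b 0 d by rewrite -c0 submxK.
  have /andP[ua ud] : (a \in unitmx) && (d \in unitmx).
    by move: uX; rewrite XB unitmxE det_ublock unitrM -!unitmxE.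
  have RX : row_mx Z M *m X = invmx a *m row_mx Z M.
    apply: (can_inj (mulKmx ua)); rewrite mulKVmx //.
    move/(congr1 usubmx): XCX; rewrite -mulmxA CRE {1}XB mul_block_col.
    by rewrite mulmx0 addr0 col_mxKu CE block_mxEv col_mxKu.
  rewrite XB -[block_mx _ _ _ _]/(block_mx a b 0 d) block_mxEh mul_mx_row !mul_row_col in RX.
  rewrite mulmx0 addr0 mul_mx_row in RX; have [Za ZbMd] := eq_row_mx RX.
  pose H := dsubmx (U *m col_mx b d).
  have bdE : col_mx b d = V *m col_mx (invmx a *m M) H.
    rewrite -ZbMd -[LHS](mulKmx uU); congr (_ *m _).
    rewrite -[LHS]vsubmxK; congr (col_mx _ _).
    by rewrite -mul_usub_mx -[usubmx U]hsubmxK mul_row_col.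
  have XS : X = lift_mx a H by rewrite XB block_mxEh bdE.
  exists a, H; split=> //; first by rewrite inE ua Za eqxx.
  by rewrite inE; move: ud; rewrite /d XS lift_mxE block_mxKdr.
have [ua /eqP aE] : a \in unitmx /\ Z *m a == invmx a *m Z.
  by apply/andP; move: aZ; rewrite inE.
have uX : lift_mx a H \in unitmx.
  by rewrite lift_mxE unitmxE det_ublock unitrM -!unitmxE ua; move: Hs; rewrite inE.
rewrite inE uX /=; apply/eqP/(can_inj (mulKmx uX)); rewrite mulKVmx // CRE R_lift.
rewrite lift_mxE mul_block_col !mulmx0 !mul0mx !addr0 CE block_mxEv row_mx0.
by rewrite mul_mx_row mulKVmx // aE mulKVmx.
Qed.

Let lift_mx_inj a H a' H' : lift_mx a H = lift_mx a' H' -> a = a' /\ H = H'.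
Proof.
move=> /eq_row_mx[/eq_col_mx[-> _]] /(can_inj (mulKmx _)) E; split=> //.
by have /E/eq_col_mx[] : V \in unitmx by rewrite unitmx_inv.
Qed.

Lemma Nstar_step_sum : Nstar C = (\sum_(a in solsZ) #|lifts a|)%N.
Proof.
rewrite /Nstar -/solsC -sum1_card (partition_big ulsubmx (mem solsZ)) /=; last first.
  by move=> X /solsCP[a [H [aZ _ ->]]]; rewrite lift_mxE block_mxKul.
apply: eq_bigr => a aZ; rewrite sum1_card.
have inj : injective (lift_mx a) by move=> H H' /lift_mx_inj[].
rewrite -(card_imset _ inj); apply: eq_card => X; rewrite unfold_in.
apply/andP/imsetP => [[/solsCP[a' [H [a'Z Hs ->]]]]|[H Hs ->]].
  by rewrite lift_mxE block_mxKul => /eqP E; subst a'; exists H; rewrite -?lift_mxE.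
split; last by rewrite lift_mxE block_mxKul.
by apply/solsCP; exists a, H.
Qed.

(** If w kills both coefficients of the affine family, then u = w V_21 satisfies
    u (Z M) = (0 w). As a Z a = Z, also u a^-1 (Z M) = 0, so u and w vanish. *)
Let card_lifts a : a \in solsZ -> #|lifts a|%:R =
   q%:R ^+ (s ^ 2) * GL_factor (s - (r - \rank Z)).
Proof.
rewrite inE => /andP[ua /eqP aE].
have -> : (s - (r - \rank Z) = \rank (drsubmx V))%N.
  by have := rank_drsubmx_invmx; have := rank_leq_row Z; lia.
apply: card_affine_unit; rewrite -kermx_eq0; apply/eqP/row_matrixP=> i; rewrite row0.
set w := row i _.
have : w *m row_mx (dlsubmx V *m invmx a *m M) (drsubmx V) = 0.
  by rewrite /w -row_mul mulmx_ker row0.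
rewrite mul_mx_row -[0 in X in _ = X]row_mx0 => /eq_row_mx[wT wG].
pose u := w *m dlsubmx V.
have uR : u *m row_mx Z M = row_mx 0 w.
  rewrite hsubmxK.
  have -> : u *m usubmx U = row_mx u (w *m drsubmx V) *m U.
    by rewrite -[U in RHS]vsubmxK mul_row_col wG mul0mx addr0.
  rewrite /u -mul_mx_row hsubmxK.
  have -> : dsubmx V = row_mx 0 1%:M *m V.
    by rewrite -[V in RHS]vsubmxK mul_row_col mul0mx mul1mx add0r.
  by rewrite -!mulmxA mulVmx // mulmx1 mul_mx_row mulmx0 mulmx1.
move: (uR); rewrite mul_mx_row => /eq_row_mx[uZ uM].
suff u0 : u *m invmx a = 0.
  by rewrite -uM -[u](mulmxKV ua) u0 !mul0mx.
apply: (row_free_inj R_free); rewrite mul0mx mul_mx_row -mulmxA -aE mulmxA uZ mul0mx.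
by move: wT; rewrite !mulmxA => ->; rewrite row_mx0.
Qed.

Lemma Nstar_step : (Nstar C)%:R =
  q%:R ^+ (s ^ 2) * GL_factor (s - (r - \rank Z)) * (Nstar Z)%:R.
Proof.
rewrite Nstar_step_sum natr_sum (eq_bigr _ card_lifts).
by rewrite sumr_const -[_ *+ _]mulr_natr.
Qed.
End Step.

(** One passes from C to its restriction to its image, whose powers have the
    ranks of the powers of C shifted by one. *)
Lemma Nstar_nilpotent K n (C : 'M[F]_n) (rk := fun j => \rank (C ^+ j)) :
  C ^+ K = 0 ->
  (Nstar C)%:R = \prod_(0 <= j < K)
    (q%:R ^+ ((rk j - rk j.+1) ^ 2) *
     GL_factor ((rk j - rk j.+1) - (rk j.+1 - rk j.+2))).
Proof.
rewrite {}/rk; elim: K => [|K IH] in n C * => CK.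
  have n0 : n = 0%N by rewrite -(mxrank1 F n) -[1%:M]/(C ^+ 0) CK mxrank0.
  subst n; rewrite big_geq // /Nstar.
  suff -> : [set X : 'M[F]_0 | (X \in unitmx) && (C *m X == invmx X *m C)] = [set 0].
    by rewrite cards1.
  apply/setP => X; rewrite !inE unitmxE [X]flatmx0 det_mx00 unitr1.
  by rewrite [C]flatmx0 mul0mx mulmx0 !eqxx.
have [s nE] : exists s, n = (\rank C + s)%N.
  by exists (n - \rank C)%N; rewrite subnKC // rank_leq_row.
move: nE; set r := \rank C => nE.
have [U [uU [P iP]]] : exists U : 'M[F]_(r + s), U \in unitmx /\
    exists P, isom_mx C (pid_mx r *m U) P.
  have := mulmx_ebase C; rewrite -/r.
  move: (col_ebase C) (row_ebase C) (col_ebase_unit C) (row_ebase_unit C).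
  clearbody r; clear -nE; subst n => A B uA uB CE.
  exists (B *m A); rewrite unitmx_mul uA uB; split=> //; exists A.
  by rewrite isom_mxE uA -CE !mulmxA eqxx.
rewrite (Nstar_isom iP) (Nstar_step uU); set Z := ulsubmx U.
have rZ j : \rank (C ^+ j.+1) = \rank (Z ^+ j).
  by rewrite (isom_mx_rankX _ iP) rank_pid_mulmx_exprS.
have ZK : Z ^+ K = 0 by apply/eqP; rewrite -mxrank_eq0 -rZ CK mxrank0.
have r0 : \rank (C ^+ 0) = (r + s)%N by rewrite [LHS]mxrank1.
rewrite (IH _ _ ZK) big_nat_recl // r0 !rZ [\rank (Z ^+ 0)]mxrank1 expr1 addKn.
by congr (_ * _); apply: eq_bigr => j _; rewrite !rZ.
Qed.

Lemma Nnilp_tail ka K : (max_part ka <= K)%N ->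
  Nnilp q ka = \prod_(0 <= j < K)
    (q%:R ^+ ((part_tail ka j - part_tail ka j.+1) ^ 2) *
     GL_factor ((part_tail ka j - part_tail ka j.+1) -
                  (part_tail ka j.+1 - part_tail ka j.+2))).
Proof.
move=> mK; have tE j : (part_tail ka j - part_tail ka j.+1)%N = count (leq j.+1) ka.
  by rewrite part_tailS addnK.
have c0 j : (max_part ka < j)%N -> count (leq j) ka = 0%N.
  by case: j => // j; rewrite ltnS -nth_dual_part => ?; rewrite nth_default ?size_dual_part.
have dE j : (\sum_(j <= i < (max_part ka).+1) count_mem i ka)%N = count (leq j) ka.
  have [jm|mj] := leqP j (max_part ka); last by rewrite big_geq ?c0.
  have dE' m : (\sum_(j <= i < j + m) count_mem i ka + count (leq (j + m)) ka)%N
             = count (leq j) ka.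
    elim: m => [|m IH]; first by rewrite addn0 big_geq.
    by rewrite addnS big_nat_recr ?leq_addr //= -addnA -count_leqS.
  have := dE' ((max_part ka).+1 - j)%N; rewrite subnKC ?(leqW jm) //.
  by rewrite (c0 _ (ltnSn _)) addn0.
have rE j : (part_tail ka j - part_tail ka j.+1 -
  (part_tail ka j.+1 - part_tail ka j.+2))%N = count_mem j.+1 ka.
  by rewrite !tE count_leqS addnK.
rewrite (big_cat_nat (leq0n _) mK) /= [X in _ = _ * X]big1_seq ?mulr1; last first.
  move=> j /=; rewrite mem_index_iota => /andP[mj _].
  have cj : count (leq j.+1) ka = 0%N by rewrite c0.
  have r0 : count_mem j.+1 ka = 0%N by move: (count_leqS ka j.+1); rewrite cj; lia.
  by rewrite rE r0 tE cj expr0 mul1r /GL_factor big_geq.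
rewrite /Nnilp big_split /= -expr_sum !big_add1 /=; congr (_ ^+ _ * _).
  by apply: eq_bigr => j _; rewrite dE tE.
by apply: eq_bigr => j _; rewrite rE.
Qed.
End NilpotentCount.

Lemma jordan_partition_isom (F : fieldType) n (C : 'M[F]_n) ka :
  jordan_partition C ka <->
  is_partition ka /\ exists P, isom_mx (nilp_mx F ka) C P.
Proof.
split=> -[pka]; last first.
  move=> [P iP]; split=> //; have e := isom_mx_dim iP; exists e; subst n.
  move: iP; rewrite castmx_id isom_mxE => /andP[uP /eqP PE].
  by exists P => //; apply/simmxP.
move=> [e [P uP /(simmxP uP) PE]]; split=> //.
have [Q iQ] := isom_mx_cast e (nilp_mx F ka).
exists (Q *m P); apply: isom_mx_trans iQ _.
by rewrite isom_mxE uP PE eqxx.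
Qed.

Lemma jordan_partition_exists (F : fieldType) n (C : 'M[F]_n) K :
  C ^+ K = 0 -> exists ka, jordan_partition C ka.
Proof.
move=> /jordan_form[ka [P [pka iP]]]; exists ka.
by apply/jordan_partition_isom; split=> //; exists P.
Qed.

Lemma Nstar_jordan_partition (F : finFieldType) n (C : 'M[F]_n) ka :
  jordan_partition C ka -> (Nstar C)%:R = Nnilp #|F| ka.
Proof.
move=> /jordan_partition_isom[pka [P iP]].
have rE j : \rank (C ^+ j) = part_tail ka j.
  by rewrite -(isom_mx_rankX _ iP) rank_nilp_mxX.
have CK : C ^+ max_part ka = 0.
  by apply/eqP; rewrite -mxrank_eq0 rE part_tail_eq0 -max_part_leq.
rewrite (Nstar_nilpotent CK) (Nnilp_tail _ (leqnn _)).
by apply: eq_bigr => j _; rewrite !rE.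
Qed.

(** * Involutions that commute with a nilpotent matrix *)

Lemma card_uniform_fibers (T T' : finType) (S : {set T}) (f : T -> T') c :
  (forall x, x \in S -> #|[set y in S | f y == f x]| = c) ->
  #|S| = (#|f @: S| * c)%N.
Proof.
move=> fc; rewrite -sum1_card (partition_big_imset f) /= -sum_nat_const.
apply: eq_bigr => _ /imsetP[x xS ->]; rewrite -(fc x xS) -sum1_card.
by apply: eq_bigl => y; rewrite inE.
Qed.

Section Involutions.
Variable F : finFieldType.
Hypothesis two_neq0 : 2%:R != 0 :> F.

Definition unit_cent n (N : 'M[F]_n) : {set 'M[F]_n} :=
  [set X | (X \in unitmx) && (X *m N == N *m X)].

Definition sign_mx a b : 'M[F]_(a + b) := block_mx 1%:M 0 0 (- 1%:M).

(** The involutions commuting with N whose eigenspaces for 1 and -1 carry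
    restrictions of N isomorphic to M1 and M2. *)
Definition split_involutions a b l (M1 : 'M[F]_a) (M2 : 'M[F]_b) (N : 'M[F]_l) :=
  [set E : 'M[F]_l | [exists P : 'M[F]_(a + b, l),
    isom_mx (block_mx M1 0 0 M2) N P && (P *m E == sign_mx a b *m P)]].

Lemma sign_mx_cent a b (Q : 'M[F]_(a + b)) :
  Q *m sign_mx a b = sign_mx a b *m Q -> Q = block_mx (ulsubmx Q) 0 0 (drsubmx Q).
Proof.
have x0 m n (x : 'M[F]_(m, n)) : - x = x -> x = 0.
  move=> /eqP; rewrite eq_sym -addr_eq0 -mulr2n -scaler_nat scaler_eq0.
  by rewrite (negPf two_neq0) => /eqP.
rewrite -{1 2}[Q]submxK !mulmx_block !(mulmx0, mul0mx, mulmx1, mul1mx, addr0, add0r).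
rewrite !(mulmxN, mulNmx, mulmx1, mul1mx).
by move=> /eq_block_mx[_ /x0 ur /esym/x0 dl _]; rewrite -ur -dl submxK.
Qed.

(** The isomorphisms P from M1 + M2 to N form a torsor under the centralizer of
    N; sending P to P^-1 (1, -1) P, two of them give the same involution when
    they differ by an automorphism of M1 + M2 that preserves both summands. *)
Lemma card_split_involutions a b l (M1 : 'M[F]_a) (M2 : 'M[F]_b) (N : 'M[F]_l) P0 :
  isom_mx (block_mx M1 0 0 M2) N P0 ->
  #|unit_cent N| =
  (#|split_involutions M1 M2 N| * (#|unit_cent M1| * #|unit_cent M2|))%N.
Proof.
move=> iP0; have e := isom_mx_dim iP0; subst l.
pose B := block_mx M1 0 0 M2; pose J := sign_mx a b.
pose S := [set P | isom_mx B N P].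
have SE P : (P \in S) = (P \in unitmx) && (P *m N == B *m P) by rewrite inE isom_mxE.
have /andP[uP0 /eqP P0E] : (P0 \in unitmx) && (P0 *m N == B *m P0).
  by rewrite -SE inE.
have -> : #|unit_cent N| = #|S|.
  rewrite -(card_imset _ (can_inj (mulKmx uP0))); apply: eq_card => P.
  apply/imsetP/idP => [[X]|].
    rewrite SE inE => /andP[uX /eqP XN] ->.
    by rewrite unitmx_mul uP0 uX -mulmxA XN !mulmxA P0E eqxx.
  rewrite SE => /andP[uP /eqP PN]; exists (invmx P0 *m P); last by rewrite mulKVmx.
  rewrite inE unitmx_mul unitmx_inv uP0 uP -mulmxA PN; apply/eqP.
  apply: (can_inj (mulKmx uP0)); rewrite !mulmxA P0E mulmxV // mul1mx.
  by rewrite mulmxK.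
pose f (P : 'M[F]_(a + b)) := invmx P *m J *m P.
have -> : split_involutions M1 M2 N = f @: S.
  apply/setP => E; rewrite inE; apply/existsP/imsetP.
    move=> [P /andP[iP /eqP PE]]; have PS : P \in S by rewrite inE.
    exists P; rewrite // /f -mulmxA -/J -PE mulKmx //.
    by move: PS; rewrite SE => /andP[].
  move=> [P PS ->]; exists P; move: (PS); rewrite SE => /andP[uP _].
  by move: PS; rewrite inE => -> /=; rewrite /f !mulmxA mulmxV // mul1mx.
apply: card_uniform_fibers => P PS.
have /andP[uP /eqP PN] : (P \in unitmx) && (P *m N == B *m P) by rewrite -SE.
pose g (Q : 'M[F]_a * 'M[F]_b) := block_mx Q.1 0 0 Q.2 *m P.
have inj : injective g.
  move=> [Q1 Q2] [R1 R2]; rewrite /g /= => /(can_inj (mulmxK uP)).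
  by move=> /eq_block_mx[-> _ _ ->].
rewrite -cardsX -(card_imset _ inj); apply: eq_card => P'.
rewrite inE SE; apply/andP/imsetP => [[/andP[uP' /eqP P'N] /eqP fP]|].
  have [Q P'E] : exists Q, P' = Q *m P by exists (P' *m invmx P); rewrite mulmxKV.
  have uQ : Q \in unitmx by move: uP'; rewrite P'E unitmx_mul uP andbT.
  have QJ : Q *m J = J *m Q.
    have E : J *m P' = P' *m f P by rewrite -fP /f !mulmxA mulmxV // mul1mx.
    by apply: (can_inj (mulmxK uP)); rewrite -[RHS]mulmxA -P'E E P'E /f !mulmxA mulmxK.
  have QB : Q *m B = B *m Q.
    apply: (can_inj (mulmxK uP)); rewrite -!mulmxA -PN -P'E mulmxA.
    by rewrite -P'E.
  have QE := sign_mx_cent QJ.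
  exists (ulsubmx Q, drsubmx Q); last by rewrite /g /= -QE.
  rewrite QE in uQ QB; move: uQ QB; rewrite unitmxE det_ublock unitrM -!unitmxE.
  move=> /andP[u1 u2]; rewrite !mulmx_block !(mulmx0, mul0mx, addr0, add0r).
  by move=> /eq_block_mx[E1 _ _ E2]; rewrite !inE /= u1 u2 E1 E2 !eqxx.
move=> [[Q1 Q2]]; rewrite !inE /= => /andP[/andP[u1 /eqP E1] /andP[u2 /eqP E2]] ->.
have uQ : block_mx Q1 0 0 Q2 \in unitmx.
  by rewrite unitmxE det_ublock unitrM -!unitmxE u1.
have QB : block_mx Q1 0 0 Q2 *m B = B *m block_mx Q1 0 0 Q2.
  by rewrite !mulmx_block !(mulmx0, mul0mx, addr0, add0r) E1 E2.
have QJ : block_mx Q1 0 0 Q2 *m J = J *m block_mx Q1 0 0 Q2.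
  rewrite !mulmx_block !(mulmx0, mul0mx, addr0, add0r, mulmxN, mulNmx).
  by rewrite !mulmx1 !mul1mx.
split; rewrite /g /=; first by rewrite unitmx_mul uQ uP -mulmxA PN !mulmxA QB eqxx.
set Q := block_mx Q1 0 0 Q2 in uQ QB QJ *.
have uQP : Q *m P \in unitmx by rewrite unitmx_mul uQ.
rewrite /f; apply/eqP/(can_inj (mulKmx uQP)).
rewrite !mulmxA mulmxV // mul1mx -QJ.
by rewrite mulmxK.
Qed.

(** The types of the two eigenspaces are invariants of the involution: 1 + E and
    1 - E are twice the projections to them. *)
Lemma split_involutions_rank mu nu l (N E : 'M[F]_l) :
  E \in split_involutions (nilp_mx F mu) (nilp_mx F nu) N ->
  [/\ E *m E = 1%:M, E *m N = N *m E,
      forall j, \rank ((1%:M + E) *m N ^+ j) = part_tail mu j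
    & forall j, \rank ((1%:M - E) *m N ^+ j) = part_tail nu j].
Proof.
rewrite inE => /existsP[P /andP[iP /eqP PE]]; have e := isom_mx_dim iP; subst l.
move: iP; rewrite isom_mxE => /andP[uP /eqP PN].
set J := sign_mx _ _ in PE; set B := block_mx _ 0 0 _ in PN.
have JJ : J *m J = 1%:M.
  rewrite mulmx_block !(mulmx0, mul0mx, addr0, add0r, mulmxN, mulNmx, opprK).
  by rewrite !mulmx1 -scalar_mx_block.
have JB : J *m B = B *m J.
  rewrite !mulmx_block !(mulmx0, mul0mx, addr0, add0r, mulmxN, mulNmx).
  by rewrite !mulmx1 !mul1mx.
split.
- apply: (can_inj (mulKmx uP)); rewrite mulmxA PE -mulmxA PE mulmxA JJ.
  by rewrite mul1mx mulmx1.
- apply: (can_inj (mulKmx uP)); rewrite !mulmxA PE PN -!mulmxA PE PN.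
  by rewrite !mulmxA JB.
- move=> j; have -> : \rank ((1%:M + E) *m N ^+ j) = \rank ((1%:M + J) *m B ^+ j).
    have fP : row_free P by rewrite row_free_unit.
    rewrite -[RHS](mxrankMfree _ fP) -mulmxA -(exprM_intertwine _ PN) mulmxA.
    have -> : (1%:M + J) *m P = P *m (1%:M + E).
      by rewrite mulmxDl mulmxDr mul1mx mulmx1 PE.
    by rewrite -mulmxA eqmxMfull ?row_full_unit.
  rewrite block_diagX scalar_mx_block add_block_mx subrr !addr0.
  rewrite mulmx_block !(mulmx0, mul0mx, addr0) rank_diag_block_mx mxrank0 addn0.
  rewrite -mulr2n -scaler_nat -scalemxAl mul1mx mxrank_scale_nz //.
  exact: rank_nilp_mxX.
- move=> j; have -> : \rank ((1%:M - E) *m N ^+ j) = \rank ((1%:M - J) *m B ^+ j).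
    have fP : row_free P by rewrite row_free_unit.
    rewrite -[RHS](mxrankMfree _ fP) -mulmxA -(exprM_intertwine _ PN) mulmxA.
    have -> : (1%:M - J) *m P = P *m (1%:M - E).
      by rewrite mulmxBl mulmxBr mul1mx mulmx1 PE.
    by rewrite -mulmxA eqmxMfull ?row_full_unit.
  rewrite block_diagX scalar_mx_block opp_block_mx add_block_mx subrr !oppr0 !addr0 opprK.
  rewrite mulmx_block !(mulmx0, mul0mx, addr0, add0r) rank_diag_block_mx mxrank0 add0n.
  rewrite -mulr2n -scaler_nat -scalemxAl mul1mx mxrank_scale_nz //.
  exact: rank_nilp_mxX.
Qed.

(** The eigenspaces are the images of 1 + E and 1 - E. *)
Lemma split_involution_exists l (N E : 'M[F]_l) K :
  N ^+ K = 0 -> E *m E = 1%:M -> E *m N = N *m E ->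
  exists mu nu, [/\ is_partition mu, is_partition nu &
    E \in split_involutions (nilp_mx F mu) (nilp_mx F nu) N].
Proof.
move=> NK EE EN.
have restr (A : 'M[F]_l) : A *m N = N *m A ->
    exists M, row_base A *m N = M *m row_base A /\ M ^+ K = 0.
  move=> AN; have fA := row_base_free A.
  have stab : (row_base A *m N <= row_base A)%MS.
    rewrite (eqmxMr _ (eq_row_base A)) AN (submx_trans (submxMl _ _)) //.
    by rewrite eq_row_base.
  exists (row_base A *m N *m pinvmx (row_base A)).
  have ME := mulmxKpV stab; split; first by rewrite ME.
  apply: (row_free_inj fA); rewrite mul0mx.
  by rewrite -(exprM_intertwine K (esym ME)) NK mulmx0.
set A1 := 1%:M + E; set A2 := 1%:M - E.
have [|M1 [M1E M1K]] := restr A1; first by rewrite mulmxDl mulmxDr mul1mx mulmx1 EN.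
have [|M2 [M2E M2K]] := restr A2; first by rewrite mulmxBl mulmxBr mul1mx mulmx1 EN.
have A1E : row_base A1 *m E = row_base A1.
  have /submxP[D ->] : (row_base A1 <= A1)%MS by rewrite eq_row_base.
  by rewrite -mulmxA mulmxDl mul1mx EE addrC.
have A2E : row_base A2 *m E = - row_base A2.
  have /submxP[D ->] : (row_base A2 <= A2)%MS by rewrite eq_row_base.
  by rewrite -mulmxA mulmxBl mul1mx EE -mulmxN opprB.
set P := col_mx (row_base A1) (row_base A2).
have uP : row_full P.
  rewrite -sub1mx.
  have -> : 1%:M = 2%:R^-1 *: (A1 + A2).
    rewrite addrACA subrr addr0 -mulr2n -scaler_nat scalerA mulVf // scale1r.
    by [].
  rewrite scalemx_sub // -addsmxE (submx_trans (addmx_sub_adds (submx_refl _) (submx_refl _))) //.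
  by rewrite (adds_eqmx (eq_row_base _) (eq_row_base _)).
have dimP : (\rank A1 + \rank A2)%N = l.
  apply/eqP; rewrite eqn_leq; apply/andP; split.
    apply: mulmx0_rank_max; rewrite mulmxBr mulmx1 mulmxDl mul1mx EE.
    by rewrite [E + _]addrC subrr.
  by rewrite -{1}(eqP uP) rank_leq_row.
have iP : isom_mx (block_mx M1 0 0 M2) N P.
  have fP : row_free P by rewrite /row_free (eqP uP) [in X in _ == X]dimP.
  rewrite /isom_mx uP fP /=.
  by rewrite mul_block_col mul_col_mx !mul0mx addr0 add0r M1E M2E.
have [mu [P1 [pmu iP1]]] := jordan_form M1K.
have [nu [P2 [pnu iP2]]] := jordan_form M2K.
exists mu, nu; split=> //; rewrite inE; apply/existsP.
exists (block_mx P1 0 0 P2 *m P).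
rewrite (isom_mx_trans (isom_mx_block iP1 iP2) iP) /= -[_ *m P *m E]mulmxA.
rewrite [P *m E]mul_col_mx A1E A2E.
apply/eqP; rewrite mulmxA mulmx_block !(mulmx0, mul0mx, addr0, add0r) mul1mx mulNmx mul1mx.
by rewrite !mul_block_col !mul0mx !addr0 !add0r mulmxN mulNmx.
Qed.

Lemma card_unit_cent_nilp la : #|unit_cent (nilp_mx F la)| = card_cent F la.
Proof. by []. Qed.

Lemma card_cent_gt0 la : (0 < card_cent F la)%N.
Proof.
by apply/card_gt0P; exists 1%:M; rewrite inE unitmx1 mul1mx mulmx1 eqxx.
Qed.

Lemma card_involutions la : is_partition la ->
  #|[set E | (E *m E == 1%:M) && (E *m nilp_mx F la == nilp_mx F la *m E)]|%:R
  = Nplus F la.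
Proof.
move=> pla; set Inv := [set E | _]; set N := nilp_mx F la.
pose O (mn : seq nat * seq nat) :=
  split_involutions (nilp_mx F mn.1) (nilp_mx F mn.2) N.
have NK : N ^+ max_part la = 0 by exact: nilp_mx_exp_max_part.
have OInv mn E : E \in O mn -> E \in Inv.
  by move=> /split_involutions_rank[EE EN _ _]; rewrite inE EE EN !eqxx.
have InvO E : E \in Inv -> exists2 mn, mn \in splits la & E \in O mn.
  rewrite inE => /andP[/eqP EE /eqP EN].
  have [mu [nu [pmu pnu EO]]] := split_involution_exists NK EE EN.
  exists (mu, nu) => //; rewrite mem_splits // pmu pnu /= eq_sym; apply/eqP.
  move: (EO); rewrite inE => /existsP[P /andP[iP _]].
  have [_ mu1] := andP pmu; have [_ nu1] := andP pnu.
  apply: join_part_tail => // j.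
  by rewrite -(rank_nilp_mxX F la) -(isom_mx_rankX _ iP) rank_block_diagX !rank_nilp_mxX.
have Ouniq E mn mn' : mn \in splits la -> mn' \in splits la ->
    E \in O mn -> E \in O mn' -> mn = mn'.
  case: mn mn' => [mu nu] [mu' nu'].
  rewrite !mem_splits // => /and3P[pmu pnu _] /and3P[pmu' pnu' _].
  move=> /split_involutions_rank[_ _ r1 r2] /split_involutions_rank[_ _ r1' r2'].
  by congr pair; apply: partition_tail_inj => // j; rewrite -?r1 -?r1' -?r2 -?r2'.
have cO mn : mn \in splits la ->
    #|O mn|%:R = (card_cent F la)%:R /
      ((card_cent F mn.1)%:R * (card_cent F mn.2)%:R) :> rat.
  case: mn => mu nu mns; move: (mns); rewrite mem_splits // => /and3P[pmu pnu /eqP laE].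
  have [P iP] : exists P, isom_mx (nilp_mx F la) (block_mx (nilp_mx F mu) 0 0 (nilp_mx F nu)) P.
    apply: jordan_form_tail => // j; rewrite rank_block_diagX !rank_nilp_mxX.
    by rewrite -part_tail_cat -laE; apply/perm_part_tail; rewrite perm_sym perm_sort.
  have [Q iQ] := isom_mx_sym iP.
  have := card_split_involutions iQ; rewrite !card_unit_cent_nilp => ->.
  rewrite !natrM mulfK // mulf_neq0 // Num.Theory.pnatr_eq0 -lt0n card_cent_gt0 //.
have -> : Nplus F la = (\sum_(mn <- splits la) #|O mn|)%N%:R.
  by rewrite natr_sum; apply: eq_big_seq => mn mns; rewrite cO.
congr (_%:R); transitivity (\sum_(mn <- splits la) \sum_E (E \in O mn))%N; last first.
  by apply: eq_bigr => mn _; rewrite -sum1_card [RHS]big_mkcond.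
rewrite exchange_big /= -sum1_card big_mkcond; apply: eq_bigr => E _.
case: ifPn => [/InvO[mn mns EO]|nE]; last first.
  rewrite big1 // => mn _; apply/eqP; rewrite eqb0.
  by apply: contra nE => /OInv.
rewrite (bigD1_seq mn) ?splits_uniq //= EO big1_seq ?addn0 // => mn' /andP[nmn mn's].
by apply/eqP; rewrite eqb0; apply: contra nmn => /(Ouniq _ _ _ mns mn's EO) ->.
Qed.
End Involutions.

(** * Polynomials over the prime field *)

Section PrimeFieldPoly.
Variable p : nat.
Hypothesis p_prime : prime p.
Implicit Types f g h : {poly 'F_p}.

Lemma pchar_nat (R : nzRingType) m : p \in [pchar R] -> [pchar R].-nat (p ^ m)%N.
Proof. by move=> pR; rewrite (eq_pnat _ (pcharf_eq pR)) pnatX pnat_id. Qed.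

Lemma Fp_exp_pX (c : 'F_p) m : c ^+ (p ^ m) = c.
Proof.
elim: m => [|m IH]; first by rewrite expn0 expr1.
by rewrite expnSr exprM IH; have := expf_card c; rewrite card_Fp.
Qed.

(** The coefficients of f are fixed by the Frobenius endomorphism. *)
Lemma comp_poly_Xp f m : f \Po 'X^(p ^ m) = f ^+ (p ^ m).
Proof.
have pP : p \in [pchar {poly 'F_p}] by rewrite pchar_poly pchar_Fp.
elim/poly_ind: f => [|f c IH].
  by rewrite comp_poly0 expr0n expn_eq0 eqn0Ngt (prime_gt0 p_prime).
rewrite comp_polyD comp_polyM comp_polyX comp_polyC IH.
by rewrite exprDn_pchar ?pchar_nat // exprMn -polyC_exp Fp_exp_pX.
Qed.

Section Irreducible.
Variable f : {poly 'F_p}.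
Hypothesis f_irr : irreducible_poly f.
Let d := (size f).-1.

(** The class of X lies in the field F_p[X]/(f), which has p^d elements. *)
Lemma irreducible_dvd_XpX m : f %| 'X^(p ^ (d * m)) - 'X.
Proof.
have f0 := irredp_neq0 f_irr; have lc0 : lead_coef f != 0 by rewrite lead_coef_eq0.
(* a monic associate of f, to form the quotient field *)
pose h := (lead_coef f)^-1 *: f.
have hf : h %= f by rewrite eqp_scale // invr_eq0.
have hM : h \is monic by rewrite monicE lead_coefZ mulVf.
have hI : monic_irreducible_poly h.
  split=> //; split; first by rewrite (eqp_size hf) f_irr.
  move=> q sq; rewrite (eqp_dvdr _ hf) => /(f_irr.2 _ sq) /eqp_trans; apply.
  by rewrite eqp_sym.
rewrite -(eqp_dvdl _ hf) /d -(eqp_size hf).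
pose L : finFieldType := {poly %/ h with hI}.
have cL : #|L| = (p ^ (size h).-1)%N by rewrite card_qfpoly card_Fp.
have xE (x : L) : x ^+ (p ^ ((size h).-1 * m)) = x.
  elim: m => [|m IH]; first by rewrite muln0 expn0 expr1.
  by rewrite mulnS expnD mulnC exprM IH -cL expf_card.
have := xE (in_qpoly h 'X : {poly %/ h}).
rewrite -[_ ^+ _](rmorphXn (in_qpoly h)) => /(congr1 val) /= /eqP.
rewrite (mk_monicE hI) -!Pdiv.IdomainMonic.modpE // => E.
by rewrite /dvdp modpD modpN (eqP E) subrr.
Qed.

(** X^(p^(dm)) - X has derivative -1, so it is squarefree. *)
Lemma XpX_factor m : (0 < m)%N -> exists2 g,
  'X^(p ^ (d * m)) - 'X = f * g & coprimep f g.
Proof.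
move=> m0; have d0 : (0 < d)%N by rewrite /d -subn1 subn_gt0; case: f_irr.
have /dvdpP[g XE] := irreducible_dvd_XpX m; exists g; first by rewrite XE mulrC.
rewrite irreducible_poly_coprime //; apply/negP => /dvdpP[h gE].
have : f %| ('X^(p ^ (d * m)) - 'X)^`().
  rewrite XE gE derivM; apply: dvdp_add; first exact: dvdp_mull.
  by rewrite dvdp_mulr // dvdp_mull.
rewrite derivB derivX derivXn -[_ *+ _]mulr_natl.
have -> : (p ^ (d * m))%:R = 0 :> {poly 'F_p}.
  apply/eqP; rewrite -(dvdn_pcharf (_ : p \in [pchar {poly 'F_p}])).
    by rewrite dvdn_exp // muln_gt0 d0.
  by rewrite pchar_poly pchar_Fp.
rewrite mul0r add0r dvdpNr dvdp1 => /eqP f1.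
by case: f_irr; rewrite f1.
Qed.

Variable K : finFieldType.
Hypothesis card_K : #|K| = (p ^ d)%N.

(** The finite field K is presented as F_p[X]/(f): since X^#|K| - X splits over K
    and f divides it, f has a root in K, and evaluation at this root is onto by
    counting polynomials of degree less than d. *)
Lemma exists_eval_surj : exists ev : {rmorphism {poly 'F_p} -> K},
  (forall h, (ev h == 0) = (f %| h)) /\ (forall a, exists h, ev h = a).
Proof.
have pK : p \in [pchar K] := card_finPcharP card_K p_prime.
have [iota] : inhabited {rmorphism 'F_p -> K}.
  by constructor; exact: (GRing.RMorphism.clone _ _ (in_alg (pPrimeCharType pK)) _).
have d0 : (0 < d)%N by rewrite /d -subn1 subn_gt0; case: f_irr.
have [al fal] : exists al : K, root (map_poly iota f) al.
  have := irreducible_dvd_XpX 1; rewrite muln1 -card_K.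
  rewrite -(dvdp_map iota) rmorphB /= map_polyXn map_polyX finField_genPoly.
  move=> /dvdp_prod_XsubC[mk fE].
  case mE: (mask mk (index_enum K)) fE => [|al t] fE.
    move: (eqp_size fE); rewrite big_nil size_map_poly size_poly1 => f1.
    by case: f_irr; rewrite f1.
  exists al; rewrite (eqp_root fE) big_cons rootM root_XsubC eqxx //.
pose ev : {rmorphism {poly 'F_p} -> K} := horner_eval al \o map_poly iota.
have ev0 h : (ev h == 0) = (f %| h).
  apply/idP/idP => [h0|/dvdpP[g ->]]; last first.
    by rewrite rmorphM /= [X in _ * X](eqP fal) mulr0.
  apply/negPn/negP; rewrite -irreducible_poly_coprime //.
  move/Bezout_eq1_coprimepP => [[u v] /= uv].
  have := congr1 ev uv; rewrite rmorphD !rmorphM rmorph1 (eqP h0) mulr0 addr0.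
  by rewrite [ev f](eqP fal) mulr0 => /eqP; rewrite eq_sym oner_eq0.
exists ev; split=> // a.
have inj : injective (fun u : 'rV['F_p]_d => ev (rVpoly u)).
  move=> u v /eqP; rewrite -subr_eq0 -rmorphB -linearB ev0 => fd.
  apply/eqP; rewrite -subr_eq0 -(inj_eq (can_inj rVpolyK)) linear0.
  apply/negPn/negP => /dvdp_leq /(_ fd); rewrite leqNgt => /negP; apply.
  by apply: leq_ltn_trans (size_poly _ _) _; rewrite /d prednK // ltnW ?f_irr.1.
have [|g _ gK] := inj_card_bij inj.
  by rewrite card_mx mul1n card_Fp // card_K.
by exists (rVpoly (g a)).
Qed.
End Irreducible.

(** Let r be a factor of f(X^2), and write r = a(X^2) + b(X^2) X. If b = 0, then f
    divides a, and r has full degree. Otherwise b has degree less than f, hence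
    an inverse v modulo f, and X is congruent to - (v a)(X^2) modulo r; squaring
    shows that f divides X - (v a)^2, against the hypothesis. *)
Lemma irreducible_comp_X2 f : irreducible_poly f ->
  (forall h, ~~ (f %| 'X - h ^+ 2)) -> irreducible_poly (f \Po 'X^2).
Proof.
move=> f_irr nsq; set g := f \Po 'X^2.
have sX2 h : h != 0 -> size (h \Po 'X^2) = ((size h).-1 * 2).+1.
  move=> h0; have hX0 : h \Po 'X^2 != 0 by rewrite comp_poly_eq0 ?size_polyXn.
  by rewrite (polySpred hX0) size_comp_poly size_polyXn.
have sg := sX2 _ (irredp_neq0 f_irr).
have d0 : (0 < (size f).-1)%N by rewrite -subn1 subn_gt0; case: f_irr.
split=> [|r sr rg]; first by rewrite sg ltnS muln_gt0 d0.
have g0 : g != 0 by rewrite -size_poly_gt0 sg.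
have r0 : r != 0 by apply: contraTneq rg => ->; rewrite dvd0p.
have srg : (size r <= size g)%N by rewrite dvdp_leq.
have r1 : ~~ (r %| 1) by rewrite dvdp1.
have fdvd h : r %| h \Po 'X^2 -> f %| h.
  move=> rh; apply/negPn/negP; rewrite -irreducible_poly_coprime //.
  move/Bezout_eq1_coprimepP => [[u v] /= uv]; case/negP: r1.
  have := congr1 (comp_poly 'X^2) uv; rewrite comp_polyD !comp_polyM rmorph1 => <-.
  by rewrite dvdp_add // dvdp_mull.
have [b0|b0] := eqVneq (odd_poly r) 0.
  have rE := poly_even_odd r; rewrite b0 comp_poly0 mul0r addr0 in rE.
  have fa : f %| even_poly r by apply: fdvd; rewrite rE.
  have /dvdpP[c aE] := fa.
  rewrite -(dvdp_size_eqp rg) eqn_leq srg /= -rE.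
  have a0 : even_poly r != 0 by apply: contraNneq r0 => a0; rewrite -rE a0 comp_poly0.
  rewrite !sX2 ?(irredp_neq0 f_irr) // ltnS leq_mul2r /=.
  by rewrite -!subn1 leq_sub2r // dvdp_leq.
have : coprimep f (odd_poly r).
  rewrite irreducible_poly_coprime //; apply/negP => /(dvdp_leq b0).
  rewrite leqNgt => /negP; apply; apply: leq_ltn_trans (size_odd_poly _) _.
  by move: srg; rewrite sg; case: (size f) d0 => // n _; lia.
move/Bezout_eq1_coprimepP => [[u v] /= uv].
case/negP: (nsq (v * even_poly r)); apply: fdvd.
pose a := even_poly r \Po 'X^2; pose b := odd_poly r \Po 'X^2; pose w := v \Po 'X^2.
have rE : a + b * 'X = r := poly_even_odd r.
have wE : w * b = 1 - (u \Po 'X^2) * g.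
  have /= := congr1 (comp_poly 'X^2) uv; rewrite comp_polyD !comp_polyM rmorph1 => <-.
  by rewrite addrAC subrr add0r.
rewrite comp_polyB comp_polyX rmorphXn /= comp_polyM -/a -/w subr_sqr.
have -> : 'X + w * a = w * r + (u \Po 'X^2) * 'X * g.
  by rewrite -rE mulrDr mulrA wE; ring.
by rewrite dvdp_mull // dvdp_add ?dvdp_mull.
Qed.
End PrimeFieldPoly.

(** * A primary matrix as a nilpotent matrix over an extension field *)

Lemma morphD0 (U V : zmodType) (g : U -> V) : {morph g : u v / u + v} -> g 0 = 0.
Proof. by move=> gD; apply: (addrI (g 0)); rewrite -gD !addr0. Qed.

Lemma linear_fun_mx (F : fieldType) m n (g : 'rV[F]_m -> 'rV[F]_n) :
  {morph g : u v / u + v} -> (forall a u, g (a *: u) = a *: g u) ->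
  exists M, forall u, g u = u *m M.
Proof.
move=> gD gZ; exists (\matrix_i g (delta_mx 0 i)) => u.
have g0 := morphD0 gD.
rewrite [u in LHS]row_sum_delta (big_morph g gD g0) mulmx_sum_row.
by apply: eq_bigr => i _; rewrite gZ rowK.
Qed.

(** The elements of F_p are integers, so additive maps are linear. *)
Lemma additive_Fp_mx p m n (g : 'rV['F_p]_m -> 'rV['F_p]_n) :
  {morph g : u v / u + v} -> exists M, forall u, g u = u *m M.
Proof.
move=> gD; apply: linear_fun_mx => // a u.
have g0 := morphD0 gD.
rewrite -[a]natr_Zp !scaler_nat; elim: (a : nat) => [|k IH]; first by rewrite !mulr0n.
by rewrite !mulrS gD IH.
Qed.

Lemma equivariantX (F F' : fieldType) m n (B : 'rV[F]_m -> 'rV[F']_n) N M j u :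
  (forall u, B (u *m N) = B u *m M) -> B (u *m N ^+ j) = B u *m M ^+ j.
Proof.
move=> BN; elim: j u => [|j IH] u; first by rewrite !expr0 !mulmx1.
by rewrite !exprS -!mulmxE !mulmxA IH BN.
Qed.

Lemma card_kermx (F : finFieldType) m n (A : 'M[F]_(m, n)) :
  #|[set v : 'rV_m | v *m A == 0]| = (#|F| ^ \rank (kermx A))%N.
Proof.
have fK := row_base_free (kermx A).
have inj : injective (fun u : 'rV_(\rank (kermx A)) => u *m row_base (kermx A)).
  exact: row_free_inj.
rewrite -[X in (_ ^ X)%N]mul1n -(@card_mx F 1) -cardsT.
rewrite -(card_imset _ inj); apply: eq_card => v; rewrite inE.
rewrite -sub_kermx; have -> : (v <= kermx A)%MS = (v <= row_base (kermx A))%MS.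
  by rewrite eq_row_base.
apply/submxP/imsetP => [[u ->]|[u _ ->]].
  by exists u.
by exists u.
Qed.

Section Descent.
Variables (p : nat) (f : {poly 'F_p}) (K : finFieldType).
Variable ev : {rmorphism {poly 'F_p} -> K}.
Hypothesis p_prime : prime p.
Hypothesis f_irr : irreducible_poly f.
Hypothesis card_K : #|K| = (p ^ (size f).-1)%N.
Hypothesis ev0 : forall h, (ev h == 0) = (f %| h).
Hypothesis ev_surj : forall a, exists h, ev h = a.
Variable n' : nat.
Local Notation n := n'.+1.

(** F_p[S] is a quotient of F_p[X]/(f), which is identified with K by ev, so the
    space of row vectors is a vector space over K. A basis is obtained as a
    family b of vectors, linearly independent over K, of maximal length: a
    vector outside its span could be added to it. *)
Lemma descent_space (S : 'M['F_p]_n) : horner_mx S f = 0 ->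
  exists l (B : 'rV[K]_l -> 'rV['F_p]_n),
  [/\ bijective B, {morph B : u v / u + v}
    & forall h u, B (ev h *: u) = B u *m horner_mx S h].
Proof.
move=> fS.
have pre a : {h | ev h == a}.
  by apply: sigW; have [h <-] := ev_surj a; exists h.
(* the action of K, through arbitrary preimages under ev *)
pose sg a := horner_mx S (sval (pre a)).
have sgE h : sg (ev h) = horner_mx S h.
  rewrite /sg; case: (pre _) => h' /= /eqP E.
  have /dvdpP[c cE] : f %| h' - h by rewrite -ev0 rmorphB E subrr.
  apply/eqP; rewrite -subr_eq0 -rmorphB cE rmorphM /= fS mulr0 //.
have sgD a b : sg (a + b) = sg a + sg b.
  have [h <-] := ev_surj a; have [h' <-] := ev_surj b.
  by rewrite -rmorphD !sgE rmorphD.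
have sgM h b : sg (ev h * b) = sg b * horner_mx S h.
  by have [h' <-] := ev_surj b; rewrite -rmorphM !sgE mulrC rmorphM.
pose Bb l (b : 'M['F_p]_(l, n)) (u : 'rV[K]_l) : 'rV['F_p]_n :=
  \sum_i row i b *m sg (u 0 i).
have BD l (b : 'M_(l, n)) : {morph Bb l b : u v / u + v}.
  move=> u v; rewrite /Bb -big_split /=; apply: eq_bigr => i _.
  by rewrite mxE sgD mulmxDr.
have BZ l (b : 'M_(l, n)) h u : Bb l b (ev h *: u) = Bb l b u *m horner_mx S h.
  rewrite /Bb mulmx_suml; apply: eq_bigr => i _.
  by rewrite mxE sgM -mulmxE mulmxA.
have B0 l (b : 'M_(l, n)) : Bb l b 0 = 0 := morphD0 (BD l b).
pose P l := [exists b : 'M['F_p]_(l, n), injectiveb (Bb l b)].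
have P0 : P 0%N.
  by apply/existsP; exists 0; apply/injectiveP => u v _; rewrite [u]thinmx0 [v]thinmx0.
have Pb l : P l -> (l <= #|{: 'rV['F_p]_n}|)%N.
  move=> /existsP[b /injectiveP inj]; apply: leq_trans (leq_card _ inj).
  rewrite card_mx mul1n; apply/ltnW/(leq_trans (ltn_expl l (_ : 1 < 2)%N)) => //.
  have [->|l0] := posnP l; first by rewrite !expn0.
  by rewrite leq_exp2r // finNzRing_gt1.
have exP : exists l, P l by exists 0%N.
case: (ex_maxnP exP Pb) => l /existsP[b /injectiveP inj] lmax.
exists l, (Bb l b); split; [|exact: BD|exact: BZ].
suff surj v : v \in codom (Bb l b).
  exists (fun v => iinv (surj v)) => [u|v]; last exact: f_iinv.
  by apply: inj; rewrite f_iinv.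
apply/negPn/negP => vB.
suff /lmax : P (1 + l)%N by rewrite add1n ltnn.
apply/existsP; exists (col_mx v b); apply/injectiveP.
have E u : Bb _ (col_mx v b) u = v *m sg (u 0 (lshift l 0)) + Bb l b (rsubmx u).
  rewrite /Bb big_split_ord big_ord1 /=; congr (_ *m _ + _).
    by apply/rowP=> j; rewrite !mxE (unsplitK (inl _ _)) ord1.
  apply: eq_bigr => i _; congr (_ *m sg _); last by rewrite mxE.
  by apply/rowP=> j; rewrite !mxE (unsplitK (inr _ _)).
suff inj0 u : Bb _ (col_mx v b) u = 0 -> u = 0.
  move=> u w uw; apply/eqP; rewrite -subr_eq0; apply/eqP/inj0.
  apply: (addIr (Bb _ (col_mx v b) w)); rewrite -BD subrK uw add0r //.
rewrite E => vu.
have [u0|u0] := eqVneq (u 0 (lshift l 0)) 0.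
  have sg0 : sg 0 = 0 by rewrite -(rmorph0 ev) sgE rmorph0.
  rewrite u0 sg0 mulmx0 add0r -(B0 l b) in vu; move/inj: vu => ur.
  rewrite -[u]hsubmxK ur; apply/rowP=> j; rewrite !mxE.
  case: splitP => k _; rewrite ?mxE // ord1 -[RHS]u0.
  by congr (u _ _); apply: val_inj; rewrite /= ?ord1.
case/negP: vB; apply/codomP.
have [h hE] := ev_surj (u 0 (lshift l 0))^-1.
exists (ev h *: - rsubmx u); rewrite BZ.
have -> : Bb l b (- rsubmx u) = v *m sg (u 0 (lshift l 0)).
  by apply: (addIr (Bb l b (rsubmx u))); rewrite -BD addNr B0 vu.
by rewrite -mulmxA mulmxE -sgM hE mulVf // -(rmorph1 ev) sgE rmorph1 mulmx1.
Qed.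

(** B identifies K^|la| with F_p^n in such a way that A^Q acts as a scalar of K,
    the class of X, and A - A^Q as the nilpotent Jordan matrix of type la. *)
Definition primary_model (A : 'M['F_p]_n) (Q : nat) (la : seq nat)
    (B : 'rV[K]_(\sum_i @part_size la i) -> 'rV['F_p]_n) : Prop :=
  [/\ bijective B, {morph B : u v / u + v},
      forall h u, B (ev h *: u) = B u *m horner_mx (A ^+ Q) h
    & forall u, B (u *m nilp_mx K la) = B u *m (A - A ^+ Q)].

Lemma horner_mx_comp (A : 'M['F_p]_n) g h :
  horner_mx A (h \Po g) = horner_mx (horner_mx A g) h.
Proof.
elim/poly_ind: h => [|h c IH]; first by rewrite comp_poly0 !rmorph0.
rewrite comp_polyD comp_polyM comp_polyX comp_polyC !rmorphD !rmorphM /= IH.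
by rewrite !horner_mx_X !horner_mx_C.
Qed.

Section Model.
Variables (A : 'M['F_p]_n) (k : nat).
Hypothesis fAk : horner_mx A f ^+ k = 0.
Let d := (size f).-1.
(* a power of p^d that is at least k *)
Let Q := (p ^ (d * k.+1))%N.
Let S := A ^+ Q.

Let d_gt0 : (0 < d)%N.
Proof. by rewrite /d -subn1 subn_gt0; case: f_irr. Qed.

Let k_leQ : (k <= Q)%N.
Proof.
apply: ltnW; apply: leq_trans (ltn_expl _ (prime_gt1 p_prime)) _.
by rewrite leq_exp2l ?prime_gt1 // (leq_trans (leqnSn k)) // leq_pmull.
Qed.

Let fS : horner_mx S f = 0.
Proof.
have -> : S = horner_mx A 'X^Q by rewrite rmorphXn /= horner_mx_X.
rewrite -horner_mx_comp comp_poly_Xp // rmorphXn /=.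
by rewrite -/Q -(subnK k_leQ) exprD fAk mulr0.
Qed.

(** X^Q - X is f times a polynomial prime to f. *)
Let nil_part : exists2 G, A - S = horner_mx A f * G &
  G \is a GRing.unit /\ GRing.comm (horner_mx A f) G.
Proof.
have [g XE cg] := XpX_factor p_prime f_irr (ltn0Sn k).
exists (- horner_mx A g).
  have := congr1 (horner_mx A) XE; rewrite rmorphB rmorphM rmorphXn /= horner_mx_X.
  by rewrite mulrN => <-; rewrite opprB.
split; last by apply/commrN/comm_horner_mx2.
rewrite unitrN; have /Bezout_eq1_coprimepP[[u v] /= uv] := coprimep_expl k cg.
have := congr1 (horner_mx A) uv; rewrite rmorphD !rmorphM rmorphXn /= fAk mulr0 add0r.
rewrite rmorph1 => vg; apply/unitrP; exists (horner_mx A v); split=> //.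
by rewrite (comm_horner_mx2 A g v).
Qed.

Lemma rank_nil_part j : \rank ((A - S) ^+ j) = \rank (horner_mx A f ^+ j).
Proof.
have [G -> [uG cG]] := nil_part.
rewrite exprMn_comm // mxrankMfree // row_free_unit.
exact: unitrX.
Qed.

(** A - S commutes with S, so it is K-linear for the structure given by S. *)
Lemma primary_model_exists : exists la B, is_partition la /\ @primary_model A Q la B.
Proof.
have [l [B [[B' BK B'K] BD BZ]]] := descent_space fS.
have B'D : {morph B' : u v / u + v}.
  by move=> u v; apply: (can_inj BK); rewrite BD !B'K.
have B'Z a v h : ev h = a -> B' (v *m horner_mx S h) = a *: B' v.
  by move=> <-; apply: (can_inj BK); rewrite BZ !B'K.
have cSA h : horner_mx S h *m (A - S) = (A - S) *m horner_mx S h.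
  have AS : comm_mx (A - S) S.
    by apply: comm_mx_sym; apply: comm_mxB => //; apply/comm_mx_sym/commrX.
  by rewrite (comm_mx_horner h AS).
have [N0 NE] : exists N : 'M[K]_l, forall u, B' (B u *m (A - S)) = u *m N.
  apply: linear_fun_mx => [u v|a u]; first by rewrite BD mulmxDl B'D.
  have [h <-] := ev_surj a; rewrite BZ -mulmxA cSA mulmxA.
  exact: B'Z.
have NB u : B (u *m N0) = B u *m (A - S) by rewrite -NE B'K.
have B0 := morphD0 BD.
have Nk : N0 ^+ k = 0.
  apply/row_matrixP => i; rewrite row0 rowE; apply: (can_inj BK).
  rewrite (equivariantX _ _ NB) B0; have -> : (A - S) ^+ k = 0; last by rewrite mulmx0.
  by apply/eqP; rewrite -mxrank_eq0 rank_nil_part fAk mxrank0.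
have [la [P [pla iP]]] := jordan_form Nk.
exists la, (fun u => B (u *m P)); split=> //.
have e := isom_mx_dim iP; move: iP; rewrite /isom_mx => /and3P[fP uP /eqP PE].
split.
- have [P' PP'] := row_freeP fP; have [P'' P''P] := row_fullP uP.
  have P'E : P' = P'' by rewrite -[P']mul1mx -P''P -mulmxA PP' mulmx1.
  exists (fun v => B' v *m P') => [u|v]; first by rewrite BK -mulmxA PP' mulmx1.
  by rewrite -mulmxA P'E P''P mulmx1 B'K.
- by move=> u v; rewrite mulmxDl BD.
- by move=> h u; rewrite -scalemxAl BZ.
by move=> u; rewrite -mulmxA -PE mulmxA NB.
Qed.

Section Consequences.
Variables (la : seq nat) (B : 'rV[K]_(\sum_i @part_size la i) -> 'rV['F_p]_n).
Hypothesis modB : @primary_model A Q la B.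
Local Notation N := (nilp_mx K la).

Lemma model_dim : n = (d * sumn la)%N.
Proof.
case: modB => bijB _ _ _; have := bij_eq_card bijB.
rewrite !card_mx !mul1n card_K card_Fp // size_nilp_mx -expnM => /eqP.
by rewrite eqn_exp2l ?prime_gt1 // => /eqP.
Qed.

(** Counting the vectors of the two kernels, which correspond under B. *)
Lemma model_rank j :
  \rank (kermx (horner_mx A f ^+ j)) = (d * (sumn la - part_tail la j))%N.
Proof.
case: modB => [[B' BK B'K] BD _ BN].
have BNX i u : B (u *m N ^+ i) = B u *m (A - S) ^+ i by exact: equivariantX.
have B0 := morphD0 BD.
rewrite mxrank_ker -rank_nil_part -mxrank_ker.
rewrite -{1}size_nilp_mx -(rank_nilp_mxX K) -mxrank_ker.
apply/eqP; rewrite -(eqn_exp2l _ _ (prime_gt1 p_prime)) expnM -card_K.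
have := card_kermx ((A - S) ^+ j); rewrite card_Fp // => <-.
rewrite -card_kermx -(card_imset _ (can_inj BK)).
apply/eqP/eq_card => v; rewrite inE; apply/eqP/imsetP => [vN|[u]].
  exists (B' v); rewrite ?B'K // inE; apply/eqP/(can_inj BK).
  by rewrite BNX B'K vN B0.
by rewrite inE => /eqP uN ->; rewrite -BNX uN B0.
Qed.

(** A matrix that commutes with A commutes with S = A^Q, hence is K-linear. *)
Lemma model_transfer : exists Phi : 'M[K]_(\sum_i @part_size la i) -> 'M['F_p]_n,
  [/\ injective Phi, {morph Phi : Y Z / Y *m Z}, Phi 1%:M = 1%:M,
      Phi ((ev 'X)%:M + N) = A
    & forall X, X *m A = A *m X -> exists2 Y, Y *m N = N *m Y & X = Phi Y].
Proof.
case: modB => [[B' BK B'K] BD BZ BN].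
have B'D : {morph B' : u v / u + v}.
  by move=> u v; apply: (can_inj BK); rewrite BD !B'K.
have PhiP Y : exists M, [forall u, B (u *m Y) == B u *m M].
  have [|M ME] := @additive_Fp_mx p n n (fun v => B (B' v *m Y)).
    by move=> u v; rewrite B'D mulmxDl BD.
  by exists M; apply/forallP => u; rewrite -ME BK.
pose Phi Y := xchoose (PhiP Y).
have PhiE Y u : B (u *m Y) = B u *m Phi Y.
  by have /forallP/(_ u)/eqP := xchooseP (PhiP Y).
have PhiI Y X : (forall u, B (u *m Y) = B u *m X) -> Phi Y = X.
  move=> YX; apply/row_matrixP => i; rewrite !rowE -(B'K (delta_mx 0 i)).
  by rewrite -PhiE YX.
exists Phi; split.
- move=> Y Z YZ; apply/row_matrixP => i; rewrite !rowE; apply: (can_inj BK).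
  by rewrite !PhiE YZ.
- by move=> Y Z; apply: PhiI => u; rewrite !mulmxA !PhiE.
- by apply: PhiI => u; rewrite !mulmx1.
- apply: PhiI => u; rewrite mulmxDr mul_mx_scalar BD BZ BN horner_mx_X -mulmxDr.
  by rewrite addrC subrK.
move=> X XA; have XS : X *m S = S *m X by exact: commrX.
have XSh h : X *m horner_mx S h = horner_mx S h *m X by exact: comm_mx_horner.
have [||Y YE] := @linear_fun_mx K _ _ (fun u => B' (B u *m X)).
- by move=> u v; rewrite BD mulmxDl B'D.
- move=> a u; have [h <-] := ev_surj a; rewrite BZ -mulmxA -XSh mulmxA.
  by apply: (can_inj BK); rewrite BZ !B'K.
have YX u : B (u *m Y) = B u *m X by rewrite -YE B'K.
exists Y; last by apply/esym/PhiI.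
apply/row_matrixP => i; rewrite !rowE !mulmxA; apply: (can_inj BK).
rewrite BN !YX BN -!mulmxA; congr (_ *m _).
by rewrite mulmxBr mulmxBl XA XS.
Qed.

End Consequences.
End Model.
End Descent.

(** * Square roots of a matrix *)

Lemma kernel_partition_uniq (F : fieldType) n (A : 'M[F]_n.+1) (f : {poly F}) k la mu :
  (1 < size f)%N ->
  kernel_partition A f k la -> kernel_partition A f k mu -> la = mu.
Proof.
move=> f1 [pla _ sla rla] [pmu _ smu rmu].
have d0 : (0 < (size f).-1)%N by rewrite -subn1 subn_gt0.
have sE j : (j <= k)%N -> (\sum_(1 <= i < j.+1) nth 0 (dual_part la) i.-1 =
    \sum_(1 <= i < j.+1) nth 0 (dual_part mu) i.-1)%N.
  case: j => [|j] jk; first by rewrite !big_geq.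
  by apply/eqP; rewrite -(eqn_pmul2l d0) -rla // -rmu.
apply: partition_count_inj => // j; rewrite -!nth_dual_part.
have [kj|jk] := leqP k j; first by rewrite !nth_default ?sla ?smu.
by have := sE _ jk; rewrite !(big_nat_recr j.+1) //= sE ?(ltnW jk) // => /addnI.
Qed.

Lemma card_square_roots (F : finFieldType) n (C : 'M[F]_n) : C \in unitmx ->
  Nstar C = #|[set D : 'M[F]_n | D *m D == C *m C]|.
Proof.
move=> uC; rewrite /Nstar -(card_imset _ (can_inj (mulKmx uC))).
apply: eq_card => D; rewrite inE; apply/imsetP/eqP => [[X]|DD].
  rewrite inE => /andP[uX /eqP CX] ->.
  by rewrite -mulmxA CX mulKVmx.
have uD : D \in unitmx.
  have : D *m D \in unitmx by rewrite DD unitmx_mul uC.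
  by rewrite unitmx_mul => /andP[].
exists (invmx C *m D); last by rewrite mulKVmx.
have uX : invmx C *m D \in unitmx by rewrite unitmx_mul unitmx_inv uC.
rewrite inE uX /=; apply/eqP/(can_inj (mulKmx uX)); rewrite !mulKVmx //.
by rewrite -mulmxA DD mulKmx.
Qed.

(** For Q a power of p such that N^Q = 0, the matrix u = 1 + N / be^2 satisfies
    u^Q = 1, and be u^((Q + 1)/2) is a square root of be^2 u. It is a polynomial
    in N. *)
Lemma nilpotent_shift_sqrt (F : fieldType) p l (N : 'M[F]_l) K (be : F) :
  p \in [pchar F] -> odd p -> be != 0 -> N ^+ K = 0 ->
  exists s, [/\ s *m s = (be ^+ 2)%:M + N, s \in unitmx
    & forall Y, Y *m N = N *m Y -> Y *m s = s *m Y].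
Proof.
move=> pF op be0; case: l => [|l] in N *.
  move=> _; exists 0; split=> [||Y _]; rewrite ?mulmx0 ?mul0mx //.
    by rewrite [_ + N]flatmx0.
  by rewrite unitmxE det_mx00 unitr1.
move=> NK; have p_prime := pcharf_prime pF.
pose Q := (p ^ K)%N; have KQ : (K <= Q)%N by rewrite ltnW // ltn_expl // prime_gt1.
have NQ : N ^+ Q = 0 by rewrite -(subnK KQ) exprD NK mulr0.
have oQ : odd Q by rewrite oddX op orbT.
have [al alE] : exists al, be ^+ 2 = al by exists (be ^+ 2).
have al0 : al != 0 by rewrite -alE expf_neq0.
rewrite alE.
pose u : {poly F} := 1 + al^-1 *: 'X.
pose r := be *: u ^+ (Q./2.+1).
have r2 : r ^+ 2 = (al%:P + 'X) * (1 + al^-1 ^+ Q *: 'X^Q).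
  rewrite /r exprZn alE -exprM.
  have -> : (Q./2.+1 * 2 = Q.+1)%N by have := odd_double_half Q; rewrite oQ; lia.
  rewrite exprS scalerAl.
  have -> : al *: u = al%:P + 'X.
    by rewrite scalerDr scalerA divff // scale1r -mul_polyC mulr1.
  have pP : p \in [pchar {poly F}] by rewrite pchar_poly.
  by rewrite exprDn_pchar ?pchar_nat // expr1n exprZn.
exists (horner_mx N r); have ss : horner_mx N r *m horner_mx N r = al%:M + N.
  rewrite mulmxE -expr2 -rmorphXn r2 rmorphM !rmorphD /= rmorph1 horner_mx_C horner_mx_X.
  by rewrite horner_mxZ [horner_mx N 'X^Q]rmorphXn /= horner_mx_X NQ scaler0 addr0 mulr1.
split=> //; last by move=> Y YN; exact: comm_mx_horner.
have : horner_mx N r *m horner_mx N r \in unitmx.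
  have qE : horner_mx N (al%:P + 'X) = al%:M + N.
    by rewrite rmorphD /= horner_mx_X horner_mx_C.
  rewrite ss; move: qE => <-; apply/unitrP.
  have cK : coprimep ('X^K) (al%:P + 'X).
    have -> : al%:P + 'X = 'X - (- al)%:P by rewrite polyCN opprK addrC.
    by apply: coprimep_expl; rewrite coprimep_XsubC rootE hornerX oppr_eq0.
  have /Bezout_eq1_coprimepP[[v w] /= vw] := cK.
  have := congr1 (horner_mx N) vw; rewrite rmorphD !rmorphM rmorphXn /= horner_mx_X NK mulr0 add0r.
  rewrite rmorph1 => wE; exists (horner_mx N w); split=> //.
  by rewrite (comm_horner_mx2 N (al%:P + 'X) w).
by rewrite unitmx_mul => /andP[].
Qed.

Lemma card_roots_involutions (F : finFieldType) p l (N : 'M[F]_l) K (be : F) :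
  p \in [pchar F] -> odd p -> be != 0 -> N ^+ K = 0 ->
  #|[set Y | Y *m Y == (be ^+ 2)%:M + N]| =
  #|[set E | (E *m E == 1%:M) && (E *m N == N *m E)]|.
Proof.
move=> pF op be0 NK.
have [s [ss us sC]] := nilpotent_shift_sqrt pF op be0 NK.
rewrite -[RHS](card_imset _ (can_inj (mulKmx us))); apply: eq_card => Y.
rewrite inE; apply/eqP/imsetP => [YY|[E]]; last first.
  rewrite inE => /andP[/eqP EE /eqP EN] ->.
  by rewrite mulmxA -[s *m E *m s]mulmxA (sC _ EN) -!mulmxA EE mulmx1.
have YN : Y *m N = N *m Y.
  have : Y *m ((be ^+ 2)%:M + N) = ((be ^+ 2)%:M + N) *m Y by rewrite -YY mulmxA.
  by rewrite mulmxDr mulmxDl scalar_mxC => /addrI.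
have Ys := sC _ YN.
have Ysi : Y *m invmx s = invmx s *m Y.
  by apply: (can_inj (mulKmx us)); rewrite mulKVmx // mulmxA -Ys mulmxK.
exists (invmx s *m Y); last by rewrite mulKVmx.
have sN : s *m N = N *m s by apply/esym/sC.
have siN : invmx s *m N = N *m invmx s.
  by apply: (can_inj (mulKmx us)); rewrite mulKVmx // mulmxA sN mulmxK.
rewrite inE mulmxA -[invmx s *m Y *m invmx s]mulmxA Ysi -!mulmxA YY -ss.
by rewrite mulKmx // mulVmx // eqxx /= YN mulmxA siN -mulmxA eqxx.
Qed.

Section PrimaryMatrix.
Variables (p : nat) (f : {poly 'F_p}) (K : finFieldType).
Variable ev : {rmorphism {poly 'F_p} -> K}.
Hypothesis p_prime : prime p.
Hypothesis f_irr : irreducible_poly f.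
Hypothesis card_K : #|K| = (p ^ (size f).-1)%N.
Hypothesis ev0 : forall h, (ev h == 0) = (f %| h).
Hypothesis ev_surj : forall a, exists h, ev h = a.
Variables (n' : nat) (A : 'M['F_p]_n'.+1) (k : nat) (la : seq nat).
Variable B : 'rV[K]_(\sum_i @part_size la i) -> 'rV['F_p]_n'.+1.
Hypothesis fAk : horner_mx A f ^+ k = 0.
Hypothesis la_part : is_partition la.
Hypothesis modB : primary_model ev A (p ^ ((size f).-1 * k.+1)) B.
Local Notation N := (nilp_mx K la).

(** The largest part of la is the nilpotency index of f(A), which is k. *)
Lemma model_kernel_partition : mxminpoly A = f ^+ k -> kernel_partition A f k la.
Proof.
move=> minA; have f1 : (1 < size f)%N by case: f_irr.
have dE := model_dim p_prime card_K modB.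
have rE j := model_rank p_prime f_irr card_K fAk modB j.
have d0 : (0 < (size f).-1)%N by rewrite -subn1 subn_gt0.
split=> //; last first.
  move=> j _; rewrite rE; congr (_ * _)%N.
  by rewrite -(sum_dual_part la j) addnK.
rewrite size_dual_part.
have mE j : (max_part la <= j)%N = (k <= j)%N.
  rewrite max_part_leq -part_tail_eq0 -(dvdp_Pexp2l _ _ f1) -minA.
  have tj : (part_tail la j <= sumn la)%N by rewrite -(sum_dual_part la j) leq_addl.
  have -> : (part_tail la j == 0)%N = (horner_mx A f ^+ j == 0).
    rewrite -mxrank_eq0; have := rE j; rewrite mxrank_ker.
    have := rank_leq_row (horner_mx A f ^+ j); rewrite mulnBr.
    move: (\rank _) => r h1 h2.
    have -> : r = ((size f).-1 * part_tail la j)%N.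
      have : ((size f).-1 * part_tail la j <= n'.+1)%N by rewrite dE leq_mul.
      by move: h1 h2; rewrite -dE; move: (_ * _)%N => t; lia.
    by rewrite muln_eq0 (gtn_eqF d0).
  rewrite -rmorphXn /=; apply/eqP/idP => [|/dvdpP[c ->]]; first exact: mxminpoly_min.
  by rewrite rmorphM /= mx_root_minpoly mulr0.
by apply/eqP; rewrite eqn_leq mE leqnn -mE leqnn.
Qed.

Lemma card_unit_cent_model : #|unit_cent A| = card_cent K la.
Proof.
have [Phi [inj PM P1 PA PX]] := model_transfer ev_surj modB.
rewrite -[RHS]/#|unit_cent N| -[RHS](card_imset _ inj).
apply: eq_card => X; rewrite inE.
apply/andP/imsetP => [[uX /eqP XA]|[Y]].
  have [Y YN XE] := PX _ XA.
  have iXA : invmx X *m A = A *m invmx X.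
    by apply: (can_inj (mulKmx uX)); rewrite mulKVmx // mulmxA XA mulmxK.
  have [Z _ ZE] := PX _ iXA.
  exists Y => //; rewrite inE YN eqxx andbT.
  have : Y *m Z = 1%:M by apply: inj; rewrite PM -XE -ZE P1 mulmxV.
  by case/mulmx1_unit.
rewrite inE => /andP[uY /eqP YN] ->; split.
  have : Phi Y *m Phi (invmx Y) = 1%:M by rewrite -PM mulmxV.
  by case/mulmx1_unit.
by rewrite -PA -!PM mulmxDr mulmxDl YN scalar_mxC.
Qed.

Lemma card_roots_model :
  #|[set D | D *m D == A]| = #|[set Y | Y *m Y == (ev 'X)%:M + N]|.
Proof.
have [Phi [inj PM P1 PA PX]] := model_transfer ev_surj modB.
rewrite -[RHS](card_imset _ inj); apply: eq_card => D; rewrite inE.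
apply/eqP/imsetP => [DD|[Y]].
  have [Y _ YE] : exists2 Y, Y *m N = N *m Y & D = Phi Y.
    by apply: PX; rewrite -DD mulmxA.
  exists Y => //; rewrite inE; apply/eqP/inj.
  by rewrite PM -YE DD PA.
by rewrite inE => /eqP YY ->; rewrite -PM YY PA.
Qed.

Lemma card_roots_split be : odd p -> be != 0 -> ev 'X = be ^+ 2 ->
  #|[set D | D *m D == A]|%:R = Nplus K la.
Proof.
move=> op be0 bE.
have pK : p \in [pchar K] := card_finPcharP card_K p_prime.
rewrite card_roots_model bE (card_roots_involutions pK op be0 (nilp_mx_exp_max_part K la)).
apply: card_involutions => //; rewrite -(dvdn_pcharf pK).
apply: contraL op => /(@dvdn_leq _ 2 isT) p2.
by move: (prime_gt1 p_prime); case: (p) p2 => [|[|[|]]].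
Qed.

End PrimaryMatrix.

(** Two matrices with the same model are both isomorphic to al + N_mu, where al is
    the class of X. *)
Lemma models_conjugate (p : nat) (K : finFieldType)
    (ev : {rmorphism {poly 'F_p} -> K}) n' Q mu (D D' : 'M['F_p]_n'.+1)
    (B B' : 'rV[K]_(\sum_i @part_size mu i) -> 'rV['F_p]_n'.+1) :
  primary_model ev D Q B -> primary_model ev D' Q B' ->
  exists2 X, X \in unitmx & D *m X = X *m D'.
Proof.
have key E C (modC : primary_model ev E Q C) u :
    C (u *m ((ev 'X)%:M + nilp_mx K mu)) = C u *m E.
  case: modC => _ CD CZ CN.
  rewrite mulmxDr mul_mx_scalar CD CZ CN horner_mx_X -mulmxDr.
  by rewrite addrC subrK.
move=> modB modB'.
have BE := key _ _ _ modB; have B'E := key _ _ _ modB'.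
case: modB modB' => [[b BK bK] BD _ _] [[b' B'K b'K] B'D _ _].
have bD : {morph b : u v / u + v}.
  by move=> u v; apply: (can_inj BK); rewrite BD !bK.
have b'D : {morph b' : u v / u + v}.
  by move=> u v; apply: (can_inj B'K); rewrite B'D !b'K.
have [|X XE] := @additive_Fp_mx p _ _ (fun v => B' (b v)).
  by move=> u v; rewrite bD B'D.
have [|Y YE] := @additive_Fp_mx p _ _ (fun v => B (b' v)).
  by move=> u v; rewrite b'D BD.
exists X.
  suff : X *m Y = 1%:M by case/mulmx1_unit.
  apply/row_matrixP => i; rewrite !rowE mulmx1 mulmxA -XE -YE B'K bK //.
apply/row_matrixP => i; rewrite !rowE !mulmxA -!XE -B'E; congr (B' _).
by apply: (can_inj BK); rewrite bK BE bK.
Qed.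

(** The matrices that conjugate C to a square root of C^2 commute with C^2, so
    the square roots of C^2 form the orbit of C under the centralizer of C^2. *)
Lemma card_conjugate_roots (F : finFieldType) n (C : 'M[F]_n) :
  (forall D, D *m D = C *m C -> exists2 X, X \in unitmx & C *m X = X *m D) ->
  #|unit_cent (C *m C)| =
  (#|[set D | D *m D == C *m C]| * #|unit_cent C|)%N.
Proof.
move=> conj; pose f (P : 'M[F]_n) := invmx P *m C *m P.
have -> : [set D | D *m D == C *m C] = f @: unit_cent (C *m C).
  apply/setP => D; rewrite inE; apply/eqP/imsetP => [DD|[P]].
    have [X uX CX] := conj _ DD; exists X; last by rewrite /f -mulmxA CX mulKmx.
    by rewrite inE uX; apply/eqP; rewrite -[RHS]mulmxA CX [RHS]mulmxA CX -[RHS]mulmxA DD.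
  rewrite inE => /andP[uP /eqP PC] ->.
  rewrite /f !mulmxA mulmxK // -[invmx P *m C *m C]mulmxA -mulmxA.
  by rewrite -PC mulKmx.
apply: card_uniform_fibers => P; rewrite inE => /andP[uP /eqP PC].
rewrite -[RHS](card_imset _ (can_inj (mulmxK uP))); apply: eq_card => R.
rewrite !inE; apply/andP/imsetP => [[/andP[uR /eqP RC] /eqP fR]|[X]].
  exists (R *m invmx P); last by rewrite mulmxKV.
  rewrite inE unitmx_mul uR unitmx_inv uP /=; apply/eqP.
  have E : C *m R = R *m f P by rewrite -fR /f !mulmxA mulmxV // mul1mx.
  by rewrite mulmxA E /f !mulmxA mulmxK.
rewrite inE => /andP[uX /eqP XC] ->.
rewrite unitmx_mul uX uP; split.
  have XCC : X *m (C *m C) = C *m C *m X by rewrite [LHS]mulmxA XC -[LHS]mulmxA XC mulmxA.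
  by apply/eqP; rewrite -[LHS]mulmxA PC [LHS]mulmxA XCC [RHS]mulmxA.
have uXP : X *m P \in unitmx by rewrite unitmx_mul uX.
rewrite /f; apply/eqP/(can_inj (mulKmx uXP)); rewrite !mulmxA mulmxV // mul1mx.
by rewrite mulmxK // XC.
Qed.

(** * The quadratic residue symbol and the theorem *)

Lemma residue_symbol_eq1 (F : finFieldType) (f : {poly F}) :
  residue_symbol 'X f = 1 -> ~~ (f %| 'X) /\ exists h, f %| 'X - h ^+ 2.
Proof.
rewrite /residue_symbol; case: ifP => // fX; case: ifP => // /existsP[h fh] _.
by split=> //; exists (h : {poly F}).
Qed.

(** The symbol ranges over representatives of degree less than deg f; any h may
    be reduced modulo f. *)
Lemma residue_symbol_eqN1 (F : finFieldType) (f : {poly F}) : (1 < size f)%N ->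
  residue_symbol 'X f = -1 -> ~~ (f %| 'X) /\ forall h, ~~ (f %| 'X - h ^+ 2).
Proof.
move=> f1; rewrite /residue_symbol; case: ifP => // fX; case: ifPn => // /existsPn nh _.
split=> // h.
have f0 : f != 0 by rewrite -size_poly_gt0 ltnW.
have sh : h %% f \is a poly_of_size (size f).-1.
  by rewrite qualifE /= -ltnS prednK ?(ltnW f1) // ltn_modp.
apply: contra (nh (NPoly sh)) => /= fh.
have -> : 'X - (h %% f) ^+ 2 = 'X - h ^+ 2 + (h - h %% f) * (h + h %% f).
  by rewrite -subr_sqr addrA subrK.
rewrite dvdp_add // dvdp_mulr // {1}(divp_eq h f) addrK dvdp_mull //.
Qed.

Lemma unit_of_primary (F : fieldType) n (C : 'M[F]_n.+1) (f : {poly F}) k :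
  irreducible_poly f -> ~~ (f %| 'X) -> horner_mx (C ^+ 2) f ^+ k = 0 -> C \in unitmx.
Proof.
move=> f_irr fX fk.
have cX : coprimep (f ^+ k) 'X by rewrite coprimep_expl // irreducible_poly_coprime.
have /Bezout_eq1_coprimepP[[u v] /= uv] := cX.
have := congr1 (horner_mx (C ^+ 2)) uv.
rewrite rmorphD !rmorphM rmorphXn /= fk mulr0 add0r horner_mx_X rmorph1.
by rewrite expr2 mulrA => /mulmx1_unit[].
Qed.

Theorem theorem1p5 (p : nat) (p_prime : prime p) (p_neq2 : p <> 2%N)
    (n : nat) (C : 'M['F_p]_n.+1) (f : {poly 'F_p}) (k : nat)
    (f_irr : irreducible_poly f)
    (minpoly_C2 : mxminpoly (C ^+ 2) = f ^+ k)
    (Fq Fq2 : finFieldType)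
    (card_Fq : #|Fq| = (p ^ (size f).-1)%N)
    (card_Fq2 : #|Fq2| = ((p ^ (size f).-1) ^ 2)%N) :
  [/\ exists! la : seq nat, kernel_partition (C ^+ 2) f k la,
      forall la : seq nat, kernel_partition (C ^+ 2) f k la ->
        (residue_symbol 'X f = 1 -> (Nstar C)%:R = Nplus Fq la) /\
        (residue_symbol 'X f = -1 ->
           (forall j : nat, (j < k)%N -> ~~ odd (nth 0%N (dual_part la) j)) /\
           exists mu : seq nat,
             [/\ is_partition mu, la = join_part mu mu
               & (Nstar C)%:R = Nminus Fq Fq2 la mu])
    & f = 'X ->
        (exists ka : seq nat, jordan_partition C ka) /\
        (forall ka : seq nat, jordan_partition C ka ->
           (Nstar C)%:R = Nnilp p ka)].
Proof.
have f1 : (1 < size f)%N by case: f_irr.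
have d0 : (0 < (size f).-1)%N by rewrite -subn1 subn_gt0.
have p_odd : odd p by case: (even_prime p_prime).
have fAk : horner_mx (C ^+ 2) f ^+ k = 0.
  by rewrite -rmorphXn /= -minpoly_C2 mx_root_minpoly.
have [ev [ev0 ev_surj]] := exists_eval_surj p_prime f_irr card_Fq.
have [la0 [B [pla modB]]] := primary_model_exists p_prime f_irr ev0 ev_surj fAk.
have kp0 := model_kernel_partition p_prime f_irr card_Fq fAk pla modB minpoly_C2.
have kpE la : kernel_partition (C ^+ 2) f k la -> la = la0.
  by move=> kp; apply: kernel_partition_uniq f1 kp kp0.
split; first by exists la0; split=> // la /kpE ->.
  move=> _ /kpE ->; split.
    move=> /residue_symbol_eq1[fX [h fh]].
    have uC := unit_of_primary f_irr fX fAk.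
    have evX : ev 'X = ev h ^+ 2.
      by apply/eqP; rewrite -subr_eq0 -rmorphXn -rmorphB ev0.
    have be0 : ev h != 0.
      by apply: contraNneq fX => h0; rewrite -ev0 evX h0 expr0n.
    rewrite (card_square_roots uC) mulmxE -expr2.
    exact: (card_roots_split p_prime card_Fq ev_surj pla modB p_odd be0 evX).
  move=> /(residue_symbol_eqN1 f1)[fX nsq].
  have uC := unit_of_primary f_irr fX fAk.
  have g_irr := irreducible_comp_X2 p_prime f_irr nsq; set g := f \Po 'X^2 in g_irr.
  have card_g : #|Fq2| = (p ^ (size g).-1)%N.
    by rewrite card_Fq2 size_comp_poly size_polyXn expnM.
  have [ev2 [ev20 ev2_surj]] := exists_eval_surj p_prime g_irr card_g.
  have gD (D : 'M['F_p]_n.+1) : D *m D = C *m C -> horner_mx D g = horner_mx (C ^+ 2) f.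
    move=> DD; rewrite horner_mx_comp rmorphXn /= horner_mx_X.
    by congr (horner_mx _ f); rewrite !expr2.
  have gDk D : D *m D = C *m C -> horner_mx D g ^+ k = 0 by move=> /gD ->.
  (* g(D) = f(A): the models of A over Fq and of D over Fq2 describe the same
     kernels, of dimensions d and 2d times those of the nilpotent parts *)
  have tailD D mu BD (DD : D *m D = C *m C)
      (modD : @primary_model p Fq2 ev2 n D (p ^ ((size g).-1 * k.+1)) mu BD) j :
      part_tail la0 j = (part_tail mu j + part_tail mu j)%N.
    have := model_rank p_prime f_irr card_Fq fAk modB j.
    have := model_dim p_prime card_Fq modB.
    have := model_rank p_prime g_irr card_g (gDk _ DD) modD j.
    rewrite (gD _ DD) => -> dimC.
    have := model_dim p_prime card_g modD.
    rewrite dimC size_comp_poly size_polyXn /= -!mulnA.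
    move=> /eqP; rewrite eqn_pmul2l // => /eqP sE /eqP; rewrite eqn_pmul2l // => /eqP.
    have := sum_dual_part mu j; have := sum_dual_part la0 j; lia.
  have [mu [BC [pmu modC]]] :=
    primary_model_exists p_prime g_irr ev20 ev2_surj (gDk C erefl).
  have tC := tailD _ _ _ erefl modC.
  have [_ mu1] := andP pmu.
  have laE : la0 = join_part mu mu by apply: join_part_tail.
  split=> [j _|].
    rewrite nth_dual_part laE.
    by rewrite (permP (permEl (perm_sort _ _))) count_cat addnn odd_double.
  exists mu; split=> //.
  have conj D : D *m D = C *m C -> exists2 X, X \in unitmx & C *m X = X *m D.
    move=> DD.
    have [nu [BD [pnu modD]]] :=
      primary_model_exists p_prime g_irr ev20 ev2_surj (gDk D DD).
    have nuE : nu = mu.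
      apply: partition_tail_inj => // j.
      by have := tailD _ _ _ DD modD j; rewrite tC; lia.
    subst nu; exact: (models_conjugate modC modD).
  have := card_conjugate_roots conj; rewrite -(card_square_roots uC).
  rewrite (card_unit_cent_model ev2_surj modC).
  rewrite mulmxE -expr2 (card_unit_cent_model ev_surj modB) /Nminus => ->.
  rewrite natrM mulfK // Num.Theory.pnatr_eq0 -lt0n card_cent_gt0 //.
move=> fX; split.
  apply: (@jordan_partition_exists _ _ _ (2 * k)%N).
  by move: fAk; rewrite fX horner_mx_X -exprM.
by move=> ka /Nstar_jordan_partition; rewrite card_Fp.
Qed.
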